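(* Let $(\mathcal{A},\varphi)$ be a $C^*$-probability space, and let $\alpha,\beta>0$ and $\lambda>1$. Let $\mathbb{X}\in\mathcal{A}$ have the free GIG distribution $\mu(-\lambda,\alpha,\beta)$ and let $\mathbb{Y}\in\mathcal{A}$ have the free Poisson distribution with rate $\lambda$ and jump size $1/\alpha$. If $\mathbb{X}$ and $\mathbb{Y}$ are free, then $$\mathbb{U}=(\mathbb{X}+\mathbb{Y})^{-1}\qquad\text{and}\qquad \mathbb{V}=\mathbb{X}^{-1}-(\mathbb{X}+\mathbb{Y})^{-1}$$ are free.
   Context: A $C^*$-probability space is a pair $(\mathcal{A},\varphi)$ with $\mathcal{A}$ a unital $C^*$-algebra and $\varphi:\mathcal{A}\to\mathbb{C}$ a linear functional with $\varphi(1_{\mathcal{A}})=1$ that is faithful, normal, tracial and positive. The distribution of a self-adjoint $\mathbb{X}\in\mathcal{A}$ is the compactly supported probability measure $\mu$ on $\mathbb{R}$ with $\varphi(\mathbb{X}^n)=\int t^n\,d\mu(t)$ for all $n$ (so $\mathbb{X},\mathbb{Y}$ are self-adjoint). Freeness is in the sense of Voiculescu: two elements are free if the unital algebras they generate are free with respect to $\varphi$. Free GIG distribution: for $\lambda\in\mathbb{R}$, $\alpha,\beta>0$, $\mu(\lambda,\alpha,\beta)$ is the probability measure supported on $[a,b]$ with density $$\frac{1}{2\pi}\sqrt{(x-a)(b-x)}\left(\frac{\alpha}{x}+\frac{\beta}{\sqrt{ab}\,x^2}\right),$$ where $0<a<b$ are the solution of $$1-\lambda+\alpha\sqrt{ab}-\beta\frac{a+b}{2ab}=0,\qquad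 1+\lambda+\frac{\beta}{\sqrt{ab}}-\alpha\frac{a+b}{2}=0.$$ Free Poisson (Marchenko--Pastur) distribution with rate $\lambda\ge 0$ and jump size $\gamma>0$: the measure $\max\{0,1-\lambda\}\,\delta_0+\tilde\nu$, where $\tilde\nu$ is supported on $(\gamma(1-\sqrt\lambda)^2,\gamma(1+\sqrt\lambda)^2)$ with density $\frac{1}{2\pi\gamma x}\sqrt{4\lambda\gamma^2-(x-\gamma(1+\lambda))^2}$. Equivalently, its free cumulants are $\mathcal{R}_n=\lambda\gamma^n$, $n\ge1$. *)

(* Defs.v *)
From HB Require Import structures.
From mathcomp Require Import all_boot all_order all_algebra.
From mathcomp Require Import complex.
From mathcomp Require Import all_classical all_reals all_analysis.

Set Implicit Arguments.
Unset Strict Implicit.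
Unset Printing Implicit Defensive.

Import Order.TTheory GRing.Theory Num.Theory.
Import numFieldNormedType.Exports.

Local Open Scope classical_set_scope.
Local Open Scope complex_scope.
Local Open Scope ring_scope.

(* Unital C*-algebras. The norm is a separate real-valued field because the
   hierarchy joins the library's norms with ring structures only in
   commutative, ordered rings. The unit ring structure only provides a total
   inverse; its predicate GRing.unit is provably two-sided invertibility, so it
   restricts nothing. *)
HB.mixin Record isCStarAlgebra (R : realType) A
    of GRing.UnitAlgebra R[i] A := {
  star : A -> A ;
  starK : involutive star ;
  starD : {morph star : x y / x + y} ;
  starZ : forall (z : R[i]) (x : A), star (z *: x) = conjc z *: star x ;
  starM : forall x y : A, star (x * y) = star y * star x ;
  cstar_norm : A -> R ;
  cstar_norm0_eq0 : forall x : A, cstar_norm x = 0 -> x = 0 ;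
  cstar_normZ : forall (z : R[i]) (x : A),
    cstar_norm (z *: x) = Normc.normc z * cstar_norm x ;
  ler_cstar_normD : forall x y : A,
    cstar_norm (x + y) <= cstar_norm x + cstar_norm y ;
  ler_cstar_normM : forall x y : A,
    cstar_norm (x * y) <= cstar_norm x * cstar_norm y ;
  cstar_identity : forall x : A, cstar_norm (star x * x) = cstar_norm x ^+ 2 ;
  cstar_complete : forall u : nat -> A,
    (forall e : R, 0 < e -> exists N : nat, forall m n : nat,
       (N <= m)%N -> (N <= n)%N -> cstar_norm (u m - u n) < e) ->
    exists l : A, forall e : R, 0 < e -> exists N : nat, forall n : nat,
       (N <= n)%N -> cstar_norm (u n - l) < e
}.

#[short(type="cstarAlgType")]
HB.structure Definition CStarAlgebra (R : realType) :=
  { A of GRing.UnitAlgebra R[i] A & isCStarAlgebra R A }.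

Section CStarProbability.
Variables (R : realType) (A : cstarAlgType R).
Implicit Types (phi : {scalar A}) (x y : A) (D S : set A).

Definition self_adjoint : set A := [set x | star x = x].

Definition cstar_positive : set A := [set x | exists y, x = star y * y].

Definition cstar_le x y : Prop := cstar_positive (y - x).

Definition cstar_lub D x : Prop :=
  (forall y, D y -> cstar_le y x) /\
  (forall z, (forall y, D y -> cstar_le y z) -> cstar_le x z).

Definition cstar_directed D : Prop :=
  D !=set0 /\
  forall x y, D x -> D y -> exists z, [/\ D z, cstar_le x z & cstar_le y z].

(* Normality: phi preserves the suprema of increasing nets of self-adjoint
   elements, whenever such a supremum exists in A. *)
Definition normal_functional phi : Prop :=
  forall D x, D `<=` self_adjoint -> cstar_directed D -> cstar_lub D x ->
  supremums (phi @` D) (phi x).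

Record cstar_probability_space phi : Prop := {
  state1 : phi 1 = 1 ;
  state_positive : forall x, cstar_positive x -> 0 <= phi x ;
  state_faithful : forall x, phi (star x * x) = 0 -> x = 0 ;
  state_normal : normal_functional phi ;
  state_tracial : forall x y, phi (x * y) = phi (y * x)
}.

Definition unital_subalgebra S : Prop :=
  [/\ S 1, forall (z : R[i]) x y, S x -> S y -> S (z *: x + y)
    & forall x y, S x -> S y -> S (x * y)].

Definition generated_algebra x : set A := smallest unital_subalgebra [set x].

(* Voiculescu's freeness of a family of unital subalgebras: alternating
   products of centred elements are centred. *)
Definition free_subalgebras (I : Type) phi (B : I -> set A) : Prop :=
  forall (n : nat) (i : nat -> I) (a : nat -> A), (0 < n)%N ->
  (forall k, (k.+1 < n)%N -> i k <> i k.+1) ->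
  (forall k, (k < n)%N -> B (i k) (a k) /\ phi (a k) = 0) ->
  phi (\prod_(k < n) a k) = 0.

Definition free_elements phi x y : Prop :=
  free_subalgebras phi
    (fun b : bool => if b then generated_algebra x else generated_algebra y).

Definition has_distribution phi x
    (mu : probability (measurableTypeR R) R) : Prop :=
  [/\ self_adjoint x,
      exists K : set R, compact K /\ mu (~` K) = 0%E
    & forall n : nat, phi (x ^+ n) = (\int[mu]_t ((t : R) ^+ n))%:C].

End CStarProbability.

Section Distributions.
Variable R : realType.
Implicit Types mu : probability (measurableTypeR R) R.

Definition free_GIG_density (alpha beta a b x : R) : R :=
  (2 * pi)^-1 * Num.sqrt ((x - a) * (b - x)) *
  (alpha / x + beta / (Num.sqrt (a * b) * x ^+ 2)).

Definition free_GIG_endpoints (lambda alpha beta a b : R) : Prop :=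
  [/\ 0 < a, a < b,
      1 - lambda + alpha * Num.sqrt (a * b)
        - beta * ((a + b) / (2 * a * b)) = 0
    & 1 + lambda + beta / Num.sqrt (a * b) - alpha * ((a + b) / 2) = 0].

Definition is_free_GIG (lambda alpha beta : R) mu : Prop :=
  exists a b : R, free_GIG_endpoints lambda alpha beta a b /\
  forall E : set R, measurable E ->
  mu E = (\int[lebesgue_measure]_(x in E `&` `[a, b])
            (free_GIG_density alpha beta a b x)%:E)%E.

Definition free_Poisson_density (lambda gamma x : R) : R :=
  (2 * pi * gamma * x)^-1 *
  Num.sqrt (4 * lambda * gamma ^+ 2 - (x - gamma * (1 + lambda)) ^+ 2).

Definition is_free_Poisson (lambda gamma : R) mu : Prop :=
  forall E : set R, measurable E ->
  mu E = ((Num.max 0 (1 - lambda))%R%:E * \d_(0%R : R) E +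
          \int[lebesgue_measure]_(x in E `&`
              `](gamma * (1 - Num.sqrt lambda) ^+ 2)%R,
                (gamma * (1 + Num.sqrt lambda) ^+ 2)%R[)
            (free_Poisson_density lambda gamma x)%:E)%E.

End Distributions.

(* Main.v *)
Require Import Defs.
From HB Require Import structures.
From mathcomp Require Import all_boot all_order all_algebra.
From mathcomp Require Import complex.
From mathcomp Require Import all_classical all_reals all_analysis.
From mathcomp Require Import measurable_realfun ring lra zify.

Set Implicit Arguments.
Unset Strict Implicit.
Unset Printing Implicit Defensive.

Import Order.TTheory GRing.Theory Num.Theory.
Import numFieldNormedType.Exports.

Local Open Scope classical_set_scope.
Local Open Scope complex_scope.
Local Open Scope ring_scope.

(** Put [U = (X + Y)^-1] and [V = X^-1 - U].  By a criterion of Voiculescu, [U] and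
    [V] are free as soon as [phi (x) phi] vanishes on the range of the derivation
    with [U |-> U (x) 1 - 1 (x) U] and [V |-> 0] (lemma [free_of_liberation]).
    Because [X^-1 = U + V] and [X + Y = U^-1], this derivation sends [X] to
    [X (x) U X - X U (x) X] and [X + Y] to [(X + Y) (x) 1 - 1 (x) (X + Y)].  It is
    therefore a combination of the partial difference quotients [d_X] and [d_Y],
    and the Schwinger-Dyson equations
      [phi (xi_X P) = (phi (x) phi) (d_X P)],
      [phi (xi_Y P) = (phi (x) phi) (d_Y P)],
    with the conjugate variables
      [xi_X = alpha + (1 + lambda) X^-1 - beta X^-2],
      [xi_Y = alpha - (lambda - 1) Y^-1],
    evaluate it as [phi (P W)], where [W] is a sum of commutators which vanishes
    identically (lemmas [gig_poisson_conj_comm] and [liberation_form_rat]).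

    It remains to establish the Schwinger-Dyson equations for the rational
    expressions in [X] and [Y] that occur.

    In one variable, both distributions have a density [al / t + be / t^2] with
    respect to a semicircle distribution.  For the semicircle the equations
    express the orthogonality of the Chebyshev polynomials, which the
    substitution [t = m + r cos x] reduces to integrals of products of sines
    (lemma [semicircle_rec]).  Moments of order at least two are polynomial moments
    of the semicircle, and this gives the equations of degree at least four
    (lemma [moment_rec]).  Dividing by [X] then reaches all degrees
    (lemma [monom_conj_pred]), and the equation of degree two determines the first
    moment.  Together with the equations for the endpoints it identifies the
    coefficients of [xi_X] (lemma [free_GIG_coefficients]).

    Freeness of [X] and [Y] extends the equations to noncommutative polynomials:
    these are spanned by centred alternating words, on which both sides vanish
    unless the word has length one (lemma [free_conj]).  Finally inverses are
    limits of polynomials by the Neumann series, in a norm that controls the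
    derivatives too, and the equations pass to the limit (lemmas [gclosure_inv] and
    [conj_eq_closure]).

    The Neumann series requires that [X], [Y] and [X + Y] lie closer to a positive
    scalar [m] than [m].  This follows from the supports of the two distributions,
    because a faithful state determines norms through moments
    (lemma [norm_le_of_moments]). *)

(** * Norm limits, inverses and square roots in a C*-algebra *)

Lemma halfC (R : rcfType) : (2^-1 : R)%:C + (2^-1 : R)%:C = 1 :> R[i].
Proof. by rewrite -rmorphD /= -[2^-1]mul1r -splitr. Qed.

Local Notation nrm := (@cstar_norm _ _).

Section NormBasics.
Variables (R : realType) (A : cstarAlgType R).
Implicit Types (x y z : A) (c : R[i]).

Lemma cstar_norm0 : nrm (0 : A) = 0.
Proof. by rewrite -(scale0r (0 : A)) cstar_normZ Normc.normc0 mul0r. Qed.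

Lemma cstar_normN x : nrm (- x) = nrm x.
Proof. by rewrite -scaleN1r cstar_normZ normcN Normc.normc1 mul1r. Qed.

Lemma cstar_norm_ge0 x : 0 <= nrm x.
Proof.
have := ler_cstar_normD x (- x).
by rewrite subrr cstar_norm0 cstar_normN -mulr2n pmulrn_lge0.
Qed.

Lemma cstar_norm_eq0 x : (nrm x == 0) = (x == 0).
Proof.
by apply/eqP/eqP => [/cstar_norm0_eq0 //|->]; exact: cstar_norm0.
Qed.

Lemma star1 : star (1 : A) = 1.
Proof. by have := starM (star (1 : A)) 1; rewrite mulr1 !starK mulr1 => <-. Qed.

Lemma cstar_norm1 : nrm (1 : A) = 1.
Proof.
have := cstar_identity (1 : A); rewrite star1 mulr1 expr2 => /esym/eqP.
rewrite -subr_eq0 -{3}[nrm 1]mulr1 -mulrBr mulf_eq0 cstar_norm_eq0 oner_eq0 /=.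
by rewrite subr_eq0 => /eqP.
Qed.

Lemma cstar_normZr (r : R) x : 0 <= r -> nrm (r%:C *: x) = r * nrm x.
Proof.
by move=> r0; rewrite cstar_normZ /= expr0n addr0 sqrtr_sqr ger0_norm.
Qed.

Lemma cstar_norm_star x : nrm (star x) = nrm x.
Proof.
have aux y : nrm y <= nrm (star y).
  have [->|yn0] := eqVneq (nrm y) 0; first exact: cstar_norm_ge0.
  have y0 : 0 < nrm y by rewrite lt_def yn0 cstar_norm_ge0.
  by rewrite -(ler_pM2r y0) -expr2 -cstar_identity ler_cstar_normM.
by apply/eqP; rewrite eq_le aux -{2}(@starK R A x) aux.
Qed.

Lemma ler_cstar_normX x n : nrm (x ^+ n) <= nrm x ^+ n.
Proof.
elim: n => [|n IH]; first by rewrite !expr0 cstar_norm1.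
rewrite !exprS (le_trans (ler_cstar_normM _ _))//.
by rewrite ler_wpM2l// cstar_norm_ge0.
Qed.

Lemma ler_cstar_normB x y : nrm (x - y) <= nrm x + nrm y.
Proof. by rewrite (le_trans (ler_cstar_normD _ _))// cstar_normN. Qed.

Lemma star0 : star (0 : A) = 0.
Proof. by rewrite -(scale0r (0 : A)) starZ conjc0 !scale0r. Qed.

Lemma starN x : star (- x) = - star x.
Proof. by rewrite -scaleN1r starZ -[in RHS]scaleN1r rmorphN1. Qed.

Lemma starB x y : star (x - y) = star x - star y.
Proof. by rewrite starD starN. Qed.

Lemma starX x n : star (x ^+ n) = star x ^+ n.
Proof.
by elim: n => [|n IH]; rewrite ?expr0 ?star1// exprS starM IH -exprSr.
Qed.

Lemma starZr (r : R) x : star (r%:C *: x) = r%:C *: star x.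
Proof. by rewrite starZ conjc_real. Qed.

Definition norm_cvg (u : nat -> A) l :=
  forall e : R, 0 < e -> exists N : nat, forall n, (N <= n)%N -> nrm (u n - l) < e.

Lemma norm_cvg_unique u l l' : norm_cvg u l -> norm_cvg u l' -> l = l'.
Proof.
move=> ul ul'; apply/eqP; rewrite -subr_eq0 -cstar_norm_eq0.
apply/eqP/le_anti; rewrite cstar_norm_ge0 andbT.
apply/ler_addgt0Pr => e e0; rewrite add0r.
have [N HN] := ul _ (divr_gt0 e0 (@ltr0n R 2)).
have [M HM] := ul' _ (divr_gt0 e0 (@ltr0n R 2)).
have := HN _ (leq_maxl N M); have := HM _ (leq_maxr N M).
set n := maxn _ _ => h1 h2.
have -> : l - l' = (u n - l') - (u n - l) by rewrite opprB addrCA addrAC subrr add0r addrC.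
by apply: (le_trans (ler_cstar_normB _ _)); rewrite (splitr e) ltW// ltrD.
Qed.

Lemma norm_cvgD u v l l' : norm_cvg u l -> norm_cvg v l' ->
  norm_cvg (fun n => u n + v n) (l + l').
Proof.
move=> ul vl e e0.
have [N HN] := ul _ (divr_gt0 e0 (@ltr0n R 2)).
have [M HM] := vl _ (divr_gt0 e0 (@ltr0n R 2)).
exists (maxn N M) => n; rewrite geq_max => /andP[Nn Mn].
rewrite opprD addrACA (le_lt_trans (ler_cstar_normD _ _))// (splitr e).
by rewrite ltrD// ?HN ?HM.
Qed.

Lemma norm_cvg_cst l : norm_cvg (fun=> l) l.
Proof. by move=> e e0; exists 0%N => n _; rewrite subrr cstar_norm0. Qed.

Lemma norm_cvg_lip (f : A -> A) (k : R) u l :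
  (forall x y, nrm (f x - f y) <= k * nrm (x - y)) ->
  norm_cvg u l -> norm_cvg (fun n => f (u n)) (f l).
Proof.
move=> fk ul e e0.
have k1 : 0 < `|k| + 1 by rewrite ltr_pwDr.
have [N HN] := ul _ (divr_gt0 e0 k1).
exists N => n /HN; rewrite ltr_pdivlMr// mulrC; apply: le_lt_trans.
rewrite (le_trans (fk _ _))// ler_wpM2r ?cstar_norm_ge0//.
by rewrite (le_trans (ler_norm k))// lerDl.
Qed.

Lemma norm_cvgMl a u l : norm_cvg u l -> norm_cvg (fun n => a * u n) (a * l).
Proof.
by apply: norm_cvg_lip (nrm a) _ _ _ => x y; rewrite -mulrBr ler_cstar_normM.
Qed.

Lemma norm_cvgMr a u l : norm_cvg u l -> norm_cvg (fun n => u n * a) (l * a).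
Proof.
apply: (@norm_cvg_lip (fun x => x * a) (nrm a)) => x y.
by rewrite -mulrBl mulrC ler_cstar_normM.
Qed.

Lemma norm_cvg_star u l : norm_cvg u l -> norm_cvg (fun n => star (u n)) (star l).
Proof.
apply: (@norm_cvg_lip (@star R A) 1) => x y.
by rewrite -starB cstar_norm_star mul1r.
Qed.

Lemma norm_cvg_le (b : R) u l :
  norm_cvg u l -> (forall n, nrm (u n) <= b) -> nrm l <= b.
Proof.
move=> ul ub; apply/ler_addgt0Pr => e e0.
have [N /(_ N (leqnn N)) h] := ul _ e0.
have -> : l = u N - (u N - l) by rewrite subKr.
by rewrite (le_trans (ler_cstar_normB _ _))// lerD// ltW.
Qed.

Lemma norm_cvgS u l : norm_cvg u l -> norm_cvg (fun n => u n.+1) l.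
Proof. by move=> ul e /ul[N HN]; exists N => n Nn; apply: HN; rewrite leqW. Qed.

Lemma norm_cvg_cauchy_by (r : nat -> R) (u : nat -> A) :
  (forall n, nrm (u n.+1 - u n) <= r n.+1 - r n) ->
  (forall e, 0 < e -> exists N, forall m n, (N <= m)%N -> (m <= n)%N -> r n - r m < e) ->
  exists l, norm_cvg u l.
Proof.
move=> ur rc.
have step m k : nrm (u (m + k)%N - u m) <= r (m + k)%N - r m.
  elim: k => [|k IH]; first by rewrite addn0 !subrr cstar_norm0.
  have -> : u (m + k.+1)%N - u m = (u (m + k).+1 - u (m + k)%N) + (u (m + k)%N - u m).
    by rewrite addnS subrKA.
  rewrite (le_trans (ler_cstar_normD _ _))// addnS.
  by rewrite (le_trans (lerD (ur _) IH))// subrKA.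
apply: cstar_complete => e /rc[N HN]; exists N => m n Nm Nn.
case/orP: (leq_total m n) => mn.
  rewrite -cstar_normN opprB -(subnKC mn) (le_lt_trans (step _ _))//.
  by rewrite subnKC// HN.
rewrite -(subnKC mn) (le_lt_trans (step _ _))//.
by rewrite subnKC// HN.
Qed.

(** The Neumann series of [x] converges to the inverse. *)
Lemma unit_1subr x : nrm x < 1 -> 1 - x \is a GRing.unit.
Proof.
move=> x1; set q := nrm x in x1; have q0 : 0 <= q := cstar_norm_ge0 x.
have q1 : 0 < 1 - q by rewrite subr_gt0.
pose u n : A := \sum_(i < n) x ^+ i.
pose r n : R := - (q ^+ n / (1 - q)).
have uS n : u n.+1 = u n + x ^+ n by rewrite /u big_ord_recr.
have qcvg : forall e : R, 0 < e -> exists N : nat, forall n, (N <= n)%N -> q ^+ n < e.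
  move=> e e0; have q1' : `|q| < 1 by rewrite ger0_norm.
  have /cvgrPdist_lt/(_ e e0)[N _ HN] := cvg_expr q1'.
  exists N => n Nn; have := HN n Nn.
  by rewrite sub0r normrN ger0_norm// exprn_ge0.
have [l ul] : exists l, norm_cvg u l.
  apply: (@norm_cvg_cauchy_by r) => [n|e e0].
    rewrite uS addrAC subrr add0r (le_trans (ler_cstar_normX _ _))//.
    rewrite -/q /r opprK addrC -mulrBl exprS -[X in (X - _) / _]mul1r -mulrBl.
    by rewrite mulrAC divff ?mul1r// gt_eqF.
  have [N HN] := qcvg _ (mulr_gt0 e0 q1); exists N => m n Nm mn.
  rewrite /r opprK addrC -mulrBl ltr_pdivrMr//.
  by rewrite (le_lt_trans _ (HN m Nm))// gerBl exprn_ge0.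
have pcvg : norm_cvg (fun n => x ^+ n) 0.
  move=> e /qcvg[N HN]; exists N => n /HN; rewrite subr0; apply: le_lt_trans.
  exact: ler_cstar_normX.
have c1 : norm_cvg (fun n => 1 - x ^+ n) 1.
  have := norm_cvgD (@norm_cvg_cst 1) (norm_cvgMl (-1) pcvg).
  rewrite mulr0 addr0; congr norm_cvg.
  by apply/funext => n; rewrite mulN1r.
have eqr n : (1 - x) * u n = 1 - x ^+ n by rewrite -[RHS]opprB subrX1 -mulNr opprB.
have cx n : x * u n = u n * x.
  by rewrite /u mulr_sumr mulr_suml; apply: eq_bigr => i _; rewrite -exprS -exprSr.
apply/unitrP; exists l; split.
  apply: norm_cvg_unique (norm_cvgMr (1 - x) ul) _.
  by under eq_fun do rewrite mulrBr mulr1 -cx -[X in X - _]mul1r -mulrBl eqr.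
apply: norm_cvg_unique (norm_cvgMl (1 - x) ul) _.
by under eq_fun do rewrite eqr.
Qed.

Lemma unit_near_scalar x (m : R) : nrm (x - m%:C%:A) < m -> x \is a GRing.unit.
Proof.
move=> xm; have m0 : 0 < m by rewrite (le_lt_trans _ xm)// cstar_norm_ge0.
have mC : m%:C != 0 by rewrite eq_complex /= gt_eqF.
have -> : x = m%:C *: (1 - m%:C^-1 *: (m%:C%:A - x)).
  by rewrite scalerBr scalerA divff// scale1r subKr.
rewrite scaler_unit ?unitfE//; apply: unit_1subr.
rewrite -fmorphV cstar_normZr ?invr_ge0 ?ltW//.
by rewrite -cstar_normN opprB mulrC ltr_pdivrMr// mul1r.
Qed.

(** The fixed-point iteration for [1 - sqrt (1 - t)] at [t = 1]; it majorises
    the same iteration in the unit ball of the algebra. *)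
Fixpoint sqrt_step (n : nat) : R :=
  if n is k.+1 then (1 + sqrt_step k ^+ 2) / 2 else 0.

Lemma sqrt_step_bounds n : 0 <= sqrt_step n <= 1 /\ sqrt_step n <= sqrt_step n.+1.
Proof.
elim: n => [|n [/andP[h0 h1] h2]]; first by rewrite /= expr0n /= addr0; split; lra.
by split; [apply/andP; split; rewrite /=; nra|rewrite /= in h2 *; nra].
Qed.

Lemma sqrt_step_cauchy e : 0 < e -> exists N, forall m n,
  (N <= m)%N -> (m <= n)%N -> sqrt_step n - sqrt_step m < e.
Proof.
move=> e0.
have nd : nondecreasing_seq sqrt_step.
  by apply/nondecreasing_seqP => n; have [] := sqrt_step_bounds n.
have ub : has_ubound (range sqrt_step).
  by exists 1 => _ [n _ <-]; have [/andP[]] := sqrt_step_bounds n.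
have cv := nondecreasing_cvgn nd ub.
have /cvgrPdist_lt/(_ e e0)[N _ HN] := cv.
exists N => m n Nm mn; have := HN m Nm; apply: le_lt_trans.
rewrite (le_trans _ (ler_norm _))// lerD2r.
by apply: (ub_le_sup ub); exists n.
Qed.

(** Square roots of [1 - x] on the closed unit ball: the fixed point of
    [y = (x + y^2) / 2].  The iteration is dominated by its scalar version at
    [x = 1], which is increasing and bounded, so it converges even when
    [nrm x = 1]. *)
Lemma sqrt_1subr x : star x = x -> nrm x <= 1 ->
  exists y, [/\ star y = y, nrm y <= 1, (1 - y) ^+ 2 = 1 - x &
    forall z, GRing.comm z x -> GRing.comm z y].
Proof.
move=> sx x1; pose h : R[i] := (2^-1 : R)%:C.
have h2 : h + h = 1 by exact: halfC.
pose u := fix u n : A := if n is k.+1 then h *: (x + u k * u k) else 0.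
have uS n : u n.+1 = h *: (x + u n * u n) by [].
have hn y : nrm (h *: y) = 2^-1 * nrm y by rewrite cstar_normZr// invr_ge0.
have ub n : nrm (u n) <= sqrt_step n.
  elim: n => [|n IH]; first by rewrite /= cstar_norm0.
  rewrite uS hn /= mulrC ler_wpM2r ?invr_ge0//.
  rewrite (le_trans (ler_cstar_normD _ _))// lerD//.
  rewrite (le_trans (ler_cstar_normM _ _))// -expr2.
  have [/andP[? ?] _] := sqrt_step_bounds n.
  by rewrite lerXn2r// nnegrE ?cstar_norm_ge0.
have ud n : nrm (u n.+1 - u n) <= sqrt_step n.+1 - sqrt_step n.
  elim: n => [|n IH].
    have [_ ] := sqrt_step_bounds 0.
    rewrite /= !mulr0 addr0 !subr0 hn expr0n addr0 mul1r => _.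
    by rewrite ler_piMr// invr_ge0.
  have -> : u n.+2 - u n.+1 =
      h *: (u n.+1 * (u n.+1 - u n) + (u n.+1 - u n) * u n).
    rewrite [u n.+2]uS [X in _ - X]uS -scalerBr opprD addrACA subrr add0r.
    by rewrite mulrBr mulrBl addrA subrK.
  rewrite hn (le_trans (ler_wpM2l _ (ler_cstar_normD _ _))) ?invr_ge0//.
  have := ler_cstar_normM (u n.+1) (u n.+1 - u n).
  have := ler_cstar_normM (u n.+1 - u n) (u n).
  have := ub n; have := ub n.+1.
  have := cstar_norm_ge0 (u n.+1 - u n).
  have := cstar_norm_ge0 (u n); have := cstar_norm_ge0 (u n.+1).
  have [/andP[? ?] ?] := sqrt_step_bounds n.
  have [/andP[? ?] ?] := sqrt_step_bounds n.+1.
  have -> : sqrt_step n.+2 - sqrt_step n.+1 =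
     2^-1 * ((sqrt_step n.+1 - sqrt_step n) * (sqrt_step n.+1 + sqrt_step n)).
    have e1 : sqrt_step n.+1 = (1 + sqrt_step n ^+ 2) / 2 by [].
    have -> : sqrt_step n.+2 = (1 + sqrt_step n.+1 ^+ 2) / 2 by [].
    by move: (sqrt_step n.+1) (sqrt_step n) e1 => r s e1; rewrite {2}e1; field.
  move: (sqrt_step n.+1) (sqrt_step n) IH => r s.
  move: (nrm (u n.+1 * (u n.+1 - u n))) (nrm ((u n.+1 - u n) * u n)) => e f.
  move: (nrm (u n.+1 - u n)) (nrm (u n.+1)) (nrm (u n)) => d a b.
  rewrite ler_pM2l ?invr_gt0// => *; nra.
have [y uy] := norm_cvg_cauchy_by ud sqrt_step_cauchy.
have u1 n : nrm (u n) <= 1.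
  by apply: le_trans (ub n) _; have [/andP[]] := sqrt_step_bounds n.
have fix_y : y = h *: (x + y * y).
  apply: norm_cvg_unique (norm_cvgS uy) _.
  have lip a b : nrm a <= 1 -> nrm b <= 1 ->
      nrm (h *: (x + a * a) - h *: (x + b * b)) <= nrm (a - b).
    move=> a1 b1; rewrite -scalerBr opprD addrACA subrr add0r.
    have -> : a * a - b * b = a * (a - b) + (a - b) * b.
      by rewrite mulrBr mulrBl addrA subrK.
    rewrite hn (le_trans (ler_wpM2l _ (ler_cstar_normD _ _))) ?invr_ge0//.
    have := ler_cstar_normM a (a - b).
    have := ler_cstar_normM (a - b) b.
    have := cstar_norm_ge0 (a - b).
    move: (nrm (a * (a - b))) (nrm ((a - b) * b)) => e f.
    move: (nrm (a - b)) (nrm a) (nrm b) a1 b1 => d a' b' *; nra.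
  have y1 := norm_cvg_le uy u1.
  by move=> e /uy[N HN]; exists N => n /HN; apply: le_lt_trans; exact: lip.
exists y; split.
- apply: norm_cvg_unique (norm_cvg_star uy) _.
  under eq_fun => n.
    have -> : star (u n) = u n.
      by elim: n => [|n IH]; rewrite ?star0// uS starZr starD starM IH sx.
    over.
  exact: uy.
- exact: norm_cvg_le uy u1.
- have : y + y = x + y * y.
    by rewrite [in LHS]fix_y -scalerDl h2 scale1r.
  rewrite expr2 mulrBr mulr1 mulrBl mul1r opprB => e.
  have -> : x = y + y - y * y by rewrite e addrK.
  by rewrite opprB opprD -addrA; congr (1 + _); rewrite addrCA.
- move=> c cx; rewrite /GRing.comm.
  apply: norm_cvg_unique (norm_cvgMl c uy) _.
  under eq_fun => n.
    have -> : c * u n = u n * c.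
      elim: n => [|n IH]; first by rewrite /= mulr0 mul0r.
      rewrite uS -scalerAr -scalerAl mulrDr mulrDl cx; congr (_ *: (_ + _)).
      by rewrite mulrA IH -mulrA IH mulrA.
    over.
  exact: norm_cvgMr.
Qed.
End NormBasics.

(** * States: continuity, and the norm from the moments *)

Lemma conjc_i (R : rcfType) : conjc 'i%C = - 'i%C :> R[i].
Proof. by apply/eqP; rewrite eq_complex /= oppr0 !eqxx. Qed.

Section States.
Variables (R : realType) (A : cstarAlgType R).
Implicit Types (x y z h k : A).

Lemma commrZ c x y : GRing.comm x y -> GRing.comm x (c *: y).
Proof. by move=> xy; rewrite /GRing.comm -scalerAr -scalerAl xy. Qed.

(** [h + i k] is a multiple of an isometry, so the C*-identity computes its
    norm, and [h] is its real part. *)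
Lemma norm_le_of_sqr_add h k (s : R) : star h = h -> star k = k ->
  GRing.comm h k -> 0 <= s -> h ^+ 2 + k ^+ 2 = (s ^+ 2)%:C%:A -> nrm h <= s.
Proof.
move=> sh sk hk s0 e; pose i : R[i] := 'i%C; pose w := h + i *: k.
have sw : star w = h - i *: k.
  by rewrite /w starD starZ sh sk conjc_i scaleNr.
have ww : star w * w = (s ^+ 2)%:C%:A.
  rewrite sw /w mulrDr !mulrBl -e -!scalerAl -!scalerAr !scalerA.
  rewrite -!expr2 hk addrA subrK.
  have -> : i ^+ 2 = -1 by rewrite /i sqr_i.
  by rewrite scaleN1r opprK.
have nw : nrm w = s.
  apply/eqP; rewrite -(eqrXn2 (n := 2))// ?cstar_norm_ge0//.
  by rewrite -cstar_identity ww cstar_normZr ?cstar_norm1 ?mulr1 ?exprn_ge0.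
have -> : h = (2^-1 : R)%:C *: (star w + w).
  by rewrite sw /w addrACA addNr addr0 scalerDr -scalerDl halfC scale1r.
rewrite cstar_normZr ?invr_ge0//.
rewrite (le_trans (ler_wpM2l _ (ler_cstar_normD _ _))) ?invr_ge0//.
by rewrite cstar_norm_star nw; lra.
Qed.

Variables (phi : {scalar A}).
Hypothesis Hphi : cstar_probability_space phi.

Lemma state_sqr_ge0 h : star h = h -> 0 <= phi (h ^+ 2).
Proof.
by move=> sh; apply: (state_positive Hphi); exists h; rewrite sh -expr2.
Qed.

Lemma stateZ c x : phi (c *: x) = c * phi x.
Proof. by rewrite linearZ. Qed.

(** Both [1 - h] and [1 + h] are squares. *)
Lemma state_real_le1 h : star h = h -> nrm h <= 1 -> Normc.normc (phi h) <= 1.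
Proof.
move=> sh h1.
have pos k : star k = k -> nrm k <= 1 -> 0 <= 1 - phi k.
  move=> sk k1; have [y [sy _ yk _]] := sqrt_1subr sk k1.
  rewrite -(state1 Hphi) -linearB -yk state_sqr_ge0//.
  by rewrite starB star1 sy.
have p1 := pos h sh h1.
have p2 : 0 <= 1 + phi h.
  by have := pos (- h); rewrite starN sh cstar_normN linearN opprK; exact.
move: p1 p2; case: (phi h) => a b; rewrite !lecE /= => /andP[/eqP b0 p1] /andP[_ p2].
have -> : b = 0 by lra.
by rewrite expr0n addr0 sqrtr_sqr ler_norml; lra.
Qed.

(** The real and imaginary parts contribute at most [nrm x] each. *)
Lemma state_bounded x : Normc.normc (phi x) <= 2 * nrm x.
Proof.
have sa h : star h = h -> Normc.normc (phi h) <= nrm h.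
  move=> sh; have [->|h0] := eqVneq h 0.
    by rewrite linear0 cstar_norm0 Normc.normc0.
  have nh : 0 < nrm h by rewrite lt_def cstar_norm_eq0 h0 cstar_norm_ge0.
  have := @state_real_le1 ((nrm h)^-1%:C *: h).
  rewrite starZr sh cstar_normZr ?invr_ge0 ?cstar_norm_ge0// mulVf ?gt_eqF//.
  move=> /(_ erefl (lexx _)).
  rewrite linearZ /= Normc.normcM /= expr0n addr0 sqrtr_sqr ger0_norm ?invr_ge0 ?cstar_norm_ge0//.
  by rewrite mulrC ler_pdivrMr// mul1r.
pose i : R[i] := 'i%C; pose c : R[i] := (2^-1 : R)%:C.
pose h := c *: (x + star x); pose k := c *: (i *: (star x - x)).
have nc y : nrm (c *: y) = 2^-1 * nrm y by rewrite cstar_normZr// invr_ge0.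
have ni y : nrm (i *: y) = nrm y.
  by rewrite cstar_normZ /= expr0n add0r expr1n sqrtr1 mul1r.
have cc : c + c = 1.
  exact: halfC.
have sh : star h = h by rewrite /h starZr starD starK addrC.
have sk : star k = k.
  rewrite /k starZr starZ starB starK.
  by rewrite conjc_i scaleNr -scalerN opprB.
have hx : nrm h <= nrm x.
  rewrite /h nc; have := ler_cstar_normD x (star x); rewrite cstar_norm_star; lra.
have kx : nrm k <= nrm x.
  rewrite /k nc ni; have := ler_cstar_normB (star x) x; rewrite cstar_norm_star; lra.
have {}hk : h + i *: k = x.
  rewrite /h /k !scalerA [i * c]mulrC -mulrA -expr2 sqr_i mulrN1 scaleNr -scalerN.
  rewrite opprB -scalerDr addrACA subrr addr0.
  by rewrite scalerDr -scalerDl cc scale1r.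
rewrite -{1}hk linearD (le_trans (le_normcD _ _))//.
rewrite (_ : phi (i *: k) = i * phi k); last exact: linearZ.
have ni1 : Normc.normc i = 1 by rewrite /i /= expr0n add0r expr1n sqrtr1.
rewrite (Normc.normcM i) ni1 mul1r.
by have := sa h sh; have := sa k sk; lra.
Qed.

(** A faithful state detects the norm of a self-adjoint element through its
    even moments.  Let [Q] be the positive part of [T^2 - s^2], up to a factor.
    Then [phi (T^2n Q^2)] grows at least like [s^2n]; it is also at most a
    constant times [phi (T^2n)], hence [phi (Q^2) = 0], [Q = 0] by faithfulness,
    and [s^2 - T^2] is a square. *)
Lemma norm_le_of_moments (T : A) (rho s : R) : star T = T -> 0 <= rho -> rho < s ->
  (forall n, phi (T ^+ (2 * n)) <= (rho ^+ (2 * n))%:C) -> nrm T <= s.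
Proof.
move=> sT rho0 rs mom; have s0 : 0 < s by rewrite (le_lt_trans rho0).
pose P := T ^+ 2; have defP : P = T ^+ 2 by []; clearbody P.
pose c : R := nrm (P - (s ^+ 2)%:C%:A) + 1.
have c0 : 0 < c by rewrite ltr_pwDr// cstar_norm_ge0.
(* [T^2 = s^2 + c Z], scaled so that [Z] lies in the unit ball. *)
pose Z := c^-1%:C *: (P - (s ^+ 2)%:C%:A).
have defZ : Z = c^-1%:C *: (P - (s ^+ 2)%:C%:A) by []; clearbody Z.
have sP : star P = P by rewrite defP starX sT.
have sa1 r : star (r%:C%:A : A) = r%:C%:A by rewrite starZr star1.
have sZ : star Z = Z by rewrite defZ starZr starB sa1 sP.
have eP : P = (s ^+ 2)%:C%:A + c%:C *: Z.
  by rewrite defZ scalerA -rmorphM /= divff ?gt_eqF// scale1r addrC subrK.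
have Z1 : nrm Z <= 1.
  rewrite defZ cstar_normZr ?invr_ge0 ?(ltW c0)// ler_pdivrMl// mulr1.
  by rewrite /c lerDl.
have commZ : GRing.comm T Z.
  rewrite defZ defP; apply: commrZ; apply: commrB; first exact: commrX.
  by rewrite /GRing.comm -scalerAr -scalerAl mulr1 mul1r.
(* [N = sqrt (1 - (1 - Z^2))] is the absolute value of [Z]; the middle step
   [G = sqrt (1 - Z^2)] keeps every square root on the closed unit ball. *)
have [y [sy y1 yZ cy]] : exists y, [/\ star y = y, nrm y <= 1, (1 - y) ^+ 2 = 1 - Z ^+ 2 &
    forall z, GRing.comm z (Z ^+ 2) -> GRing.comm z y].
  apply: sqrt_1subr; first by rewrite starX sZ.
  by rewrite (le_trans (ler_cstar_normX _ _))// expr_le1// cstar_norm_ge0.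
pose G := 1 - y; have defG : G = 1 - y by []; clearbody G.
have sG : star G = G by rewrite defG starB star1 sy.
have cG z : GRing.comm z Z -> GRing.comm z G.
  by move=> zZ; rewrite defG; apply: commrB; [exact: commr1|apply: cy; exact: commrX].
have G1 : nrm G <= 1.
  apply: (@norm_le_of_sqr_add G Z 1) => //; first by apply: commr_sym; exact: cG.
  by rewrite defG yZ subrK expr1n scale1r.
have [n [sn n1 nG cn]] : exists n, [/\ star n = n, nrm n <= 1, (1 - n) ^+ 2 = 1 - G ^+ 2 &
    forall z, GRing.comm z (G ^+ 2) -> GRing.comm z n].
  apply: sqrt_1subr; first by rewrite starX sG.
  by rewrite (le_trans (ler_cstar_normX _ _))// expr_le1// cstar_norm_ge0.
pose N := 1 - n; have defN : N = 1 - n by []; clearbody N.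
have NZ : N ^+ 2 = Z ^+ 2 by rewrite defN nG defG yZ subKr.
have sN : star N = N by rewrite defN starB star1 sn.
have cn' z : GRing.comm z Z -> GRing.comm z n.
  by move=> zZ; apply: cn; apply: commrX; exact: cG.
have cN z : GRing.comm z Z -> GRing.comm z N.
  by move=> zZ; rewrite defN; apply: commrB; [exact: commr1|exact: cn'].
have [b [sb _ bN cb]] := sqrt_1subr sn n1.
pose g := 1 - b; have defg : g = 1 - b by []; clearbody g.
have sg : star g = g by rewrite defg starB star1 sb.
have gN : g ^+ 2 = N by rewrite defg bN.
have cg z : GRing.comm z Z -> GRing.comm z g.
  by move=> zZ; rewrite defg; apply: commrB; [exact: commr1|apply: cb; exact: cn'].
pose Q := N + Z; have defQ : Q = N + Z by []; clearbody Q.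
have sQ : star Q = Q by rewrite defQ starD sN sZ.
have ZN : GRing.comm Z N by exact: cN.
have cQ z : GRing.comm z Z -> GRing.comm z Q.
  by move=> zZ; rewrite defQ; apply: commrD => //; exact: cN.
have NQ : N * Q = Z * Q.
  by rewrite defQ (mulrDr N N Z) (mulrDr Z N Z) -!expr2 NZ ZN addrC.
have ZQ2 : Z * Q ^+ 2 = (g * Q) ^+ 2.
  have gQ : GRing.comm g Q by apply: cQ; apply: commr_sym; exact: cg.
  by rewrite (exprMn_comm _ gQ) gN expr2 !mulrA NQ.
have sM u v : star u = u -> star v = v -> GRing.comm u v -> star (u * v) = u * v.
  by move=> su sv uv; rewrite starM su sv uv.
have TQ : GRing.comm T Q by exact: cQ.
have Zg : GRing.comm Z g by exact: cg.
have Tg : GRing.comm T g by exact: cg.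
have gQ : GRing.comm g Q by apply: cQ; exact: commr_sym.
pose f m := phi (P ^+ m * Q ^+ 2).
have PT m : P ^+ m = T ^+ m ^+ 2 by rewrite defP -!exprM mulnC.
(* [T^2 Q^2 = s^2 Q^2 + c Z Q^2], where [Z Q^2 = (g Q)^2]. *)
have fS m : (s ^+ 2)%:C * f m <= f m.+1.
  rewrite -subr_ge0 /f -linearZ -linearB /=.
  have -> : P ^+ m.+1 * Q ^+ 2 - (s ^+ 2)%:C *: (P ^+ m * Q ^+ 2) =
     c%:C *: (T ^+ m * (g * Q)) ^+ 2.
    rewrite exprSr {2}eP mulrDr -!scalerAr mulr1 mulrDl -!scalerAl addrAC subrr add0r.
    rewrite -(mulrA (P ^+ m)) ZQ2 PT -exprMn_comm//.
    by apply: commr_sym; apply: commrX; apply: commr_sym; apply: commrM.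
  rewrite linearZ /= mulr_ge0 ?ler0c ?(ltW c0)// state_sqr_ge0//.
  apply: (sM); rewrite ?starX ?sT//; first exact: (sM).
  by apply: commr_sym; apply: commrX; apply: commr_sym; apply: commrM.
have flow m : (s ^+ (2 * m))%:C * f 0%N <= f m.
  elim: m => [|m IH]; first by rewrite muln0 expr0 rmorph1 mul1r.
  rewrite mulnS exprD rmorphM -mulrA (le_trans _ (fS m))//.
  by rewrite ler_wpM2l// ler0c exprn_ge0// ?(ltW s0) ?(ltW q0).
pose q := nrm Q + 1.
have q0 : 0 < q by rewrite ltr_pwDr// cstar_norm_ge0.
have [d [sd _ dQ cd]] : exists d, [/\ star d = d, nrm d <= 1,
    (1 - d) ^+ 2 = 1 - (q^-1%:C *: Q) ^+ 2 &
    forall z, GRing.comm z ((q^-1%:C *: Q) ^+ 2) -> GRing.comm z d].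
  apply: sqrt_1subr; first by rewrite starX starZr sQ.
  rewrite (le_trans (ler_cstar_normX _ _))// expr_le1 ?cstar_norm_ge0//.
  rewrite cstar_normZr ?invr_ge0 ?(ltW q0)// ler_pdivrMl// mulr1.
  by rewrite /q lerDl.
(* [q^2 - Q^2] is a square commuting with [T]. *)
have fup m : f m <= (q ^+ 2)%:C * (rho ^+ (2 * m))%:C.
  apply: (@le_trans _ _ ((q ^+ 2)%:C * phi (T ^+ (2 * m)))); last first.
    by rewrite ler_wpM2l// ler0c exprn_ge0// ?(ltW s0) ?(ltW q0).
  rewrite -subr_ge0 -linearZ -linearB /=.
  have -> : (q ^+ 2)%:C *: T ^+ (2 * m) - P ^+ m * Q ^+ 2 =
     (q ^+ 2)%:C *: (T ^+ m * (1 - d)) ^+ 2.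
    rewrite (exprMn_comm _ _); last first.
      apply: commr_sym; apply: commrX; apply: commr_sym; apply: commrB; first exact: commr1.
      by apply: cd; apply: commrX; apply: commrZ.
    rewrite dQ mulrBr mulr1 -PT defP -exprM scalerBr exprZn -scalerAr scalerA.
    by rewrite -rmorphXn -rmorphM /= exprVn divff ?scale1r// expf_neq0// gt_eqF.
  rewrite linearZ /= mulr_ge0 ?ler0c ?exprn_ge0 ?(ltW q0)// state_sqr_ge0//.
  apply: (sM); rewrite ?starX ?sT ?starB ?star1 ?sd//.
  apply: commr_sym; apply: commrX; apply: commr_sym; apply: commrB; first exact: commr1.
  by apply: cd; apply: commrX; apply: commrZ.
have f0 : f 0%N = 0.
  have f00 : 0 <= f 0%N by rewrite /f expr0 mul1r state_sqr_ge0.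
  have key m : (s ^+ (2 * m))%:C * f 0%N <= (q ^+ 2)%:C * (rho ^+ (2 * m))%:C.
    exact: le_trans (flow m) (fup m).
  move: f00 key; case: (f 0%N) => a e; rewrite lecE /= => /andP[/eqP -> a0] key.
  have {}key m : s ^+ (2 * m) * a <= q ^+ 2 * rho ^+ (2 * m).
    by have := key m; rewrite complexr0 -!rmorphM /= lecR.
  suff -> : a = 0 by [].
  apply/le_anti; rewrite a0 andbT leNgt; apply/negP => a_gt0.
  pose t := (rho / s) ^+ 2.
  have t0 : 0 <= t by rewrite exprn_ge0 ?divr_ge0 ?(ltW s0).
  have t1 : `|t| < 1.
    rewrite ger0_norm ?exprn_ge0 ?divr_ge0 ?(ltW s0)// exprn_ilt1 ?divr_ge0 ?(ltW s0)//.
    by rewrite ltr_pdivrMr// mul1r.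
  have q2 : 0 < q ^+ 2 by rewrite exprn_gt0.
  have /cvgrPdist_lt/(_ _ (divr_gt0 a_gt0 q2))[M _ /(_ M (leqnn M))] := cvg_expr t1.
  rewrite sub0r normrN ger0_norm; last exact: exprn_ge0.
  rewrite ltr_pdivlMr//.
  apply/negP; rewrite -leNgt /t -exprM expr_div_n mulrAC.
  by rewrite ler_pdivlMr ?exprn_gt0// mulrC [leRHS]mulrC key.
have Q0 : Q = 0.
  apply: (state_faithful Hphi); rewrite sQ -expr2.
  by move: f0; rewrite /f expr0 mul1r.
have NmZ : N = - Z by apply/eqP; rewrite -addr_eq0 -defQ Q0.
apply: (@norm_le_of_sqr_add T ((Num.sqrt c)%:C *: g) s) => //; rewrite ?(ltW s0)//.
- by rewrite starZr sg.
- exact: commrZ.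
- rewrite exprZn gN NmZ -rmorphXn /= sqr_sqrtr ?(ltW c0)// scalerN.
  by rewrite -defP eP addrK.
Qed.
End States.

(** * Derivatives of noncommutative expressions as bilinear forms *)

Section DerivationGraphs.
Variables (R : realType) (A : cstarAlgType R) (phi : {scalar A}).
Hypothesis Hphi : cstar_probability_space phi.
Variable I : eqType.
Implicit Types (a b x y L M : A) (z : R[i]) (i j : I).

(** A tensor [t] in the bimodule [A (x) A] is represented by the bilinear form
    [(L, M) |-> (phi (x) phi) (L t M)]; a family of derivatives indexed by [I]
    by a family of such forms. *)
Definition dform := I -> A -> A -> R[i].
Implicit Types (d e : dform) (g G : A -> dform -> Prop).

Definition dlin z d e : dform := fun i L M => z * d i L M + e i L M.

(** The derivative of [a * b] by the Leibniz rule: multiplying a tensor by [b] on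
    its right leg, or by [a] on its left leg, moves into the arguments. *)
Definition dmul a d b e : dform := fun i L M => d i L (b * M) + e i (L * a) M.

Definition dzero : dform := fun _ _ _ => 0.

(** The partial difference quotient with respect to the variable [j] takes the
    value [1 (x) 1] on that variable. *)
Definition dvar j : dform :=
  fun i L M => if i == j then phi L * phi M else 0.

(** Graphs rather than functions: the derivatives of an element depend on the
    expression that represents it, and this way no well-definedness has to be
    proved. *)
Inductive dgraph g : A -> dform -> Prop :=
| dgraph_gen a d : g a d -> dgraph g a d
| dgraph1 : dgraph g 1 dzero
| dgraph_lin z a d b e :
    dgraph g a d -> dgraph g b e -> dgraph g (z *: a + b) (dlin z d e)
| dgraph_mul a d b e :
    dgraph g a d -> dgraph g b e -> dgraph g (a * b) (dmul a d b e).

Definition bilinear_form d : Prop :=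
  (forall i z L L' M, d i (z *: L + L') M = z * d i L M + d i L' M) /\
  (forall i z L M M', d i L (z *: M + M') = z * d i L M + d i L M').

Definition bounded_form (K : R) d : Prop :=
  forall i L M, Normc.normc (d i L M) <= K * nrm L * nrm M.

Definition regular_form d : Prop :=
  bilinear_form d /\ exists2 K, 0 <= K & bounded_form K d.

Lemma normc_ge0 z : 0 <= Normc.normc z.
Proof. by case: z => u v; exact: sqrtr_ge0. Qed.

Lemma bilinear_dlin z d e : bilinear_form d -> bilinear_form e ->
  bilinear_form (dlin z d e).
Proof.
move=> [d1 d2] [e1 e2]; split=> i t L L' M; rewrite /dlin.
  by rewrite d1 e1; ring.
by rewrite d2 e2; ring.
Qed.

Lemma bilinear_dmul a d b e : bilinear_form d -> bilinear_form e ->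
  bilinear_form (dmul a d b e).
Proof.
move=> [d1 d2] [e1 e2]; split=> i t L L' M; rewrite /dmul.
  by rewrite d1 mulrDl -scalerAl e1; ring.
by rewrite e2 mulrDr -scalerAr d2; ring.
Qed.

Lemma bilinear_dzero : bilinear_form dzero.
Proof. by split=> *; rewrite /dzero mulr0 addr0. Qed.

Lemma bilinear_dvar j : bilinear_form (dvar j).
Proof.
by split=> i z L L' M; rewrite /dvar; case: ifP => _; rewrite ?linearP /=; ring.
Qed.

Lemma form0l d i M : bilinear_form d -> d i 0 M = 0.
Proof.
by move=> [dl _]; have := dl i (-1) 0 0 M; rewrite scaler0 addr0 mulN1r addNr.
Qed.

Lemma form0r d i L : bilinear_form d -> d i L 0 = 0.
Proof.
by move=> [_ dr]; have := dr i (-1) L 0 0; rewrite scaler0 addr0 mulN1r addNr.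
Qed.

Lemma formZl d i z L M : bilinear_form d -> d i (z *: L) M = z * d i L M.
Proof.
by move=> dd; have [dl _] := dd; have := dl i z L 0 M; rewrite addr0 form0l// addr0.
Qed.

Lemma formZr d i z L M : bilinear_form d -> d i L (z *: M) = z * d i L M.
Proof.
by move=> dd; have [_ dr] := dd; have := dr i z L M 0; rewrite addr0 form0r// addr0.
Qed.

Lemma formDl d i L L' M : bilinear_form d -> d i (L + L') M = d i L M + d i L' M.
Proof. by move=> [dl _]; have := dl i 1 L L' M; rewrite scale1r mul1r. Qed.

Lemma formDr d i L M M' : bilinear_form d -> d i L (M + M') = d i L M + d i L M'.
Proof. by move=> [_ dr]; have := dr i 1 L M M'; rewrite scale1r mul1r. Qed.

Lemma formBl d i L L' M : bilinear_form d -> d i (L - L') M = d i L M - d i L' M.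
Proof. by move=> dd; rewrite formDl// -scaleN1r formZl// mulN1r. Qed.

Lemma formBr d i L M M' : bilinear_form d -> d i L (M - M') = d i L M - d i L M'.
Proof. by move=> dd; rewrite formDr// -scaleN1r formZr// mulN1r. Qed.

Lemma dgraph_bilinear g a d : (forall x e, g x e -> bilinear_form e) ->
  dgraph g a d -> bilinear_form d.
Proof.
move=> gb; elim=> {a d} [a d /gb//||z a d b e _ da _ eb|a d b e _ da _ eb].
- exact: bilinear_dzero.
- exact: bilinear_dlin.
- exact: bilinear_dmul.
Qed.

Lemma bounded_dlin z d e K K' : bounded_form K d -> bounded_form K' e ->
  bounded_form (Normc.normc z * K + K') (dlin z d e).
Proof.
move=> dK eK i L M; rewrite /dlin (le_trans (le_normcD _ _))// !mulrDl.
rewrite Normc.normcM lerD// -!mulrA ler_wpM2l ?normc_ge0//.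
by rewrite mulrA dK.
Qed.

Lemma bounded_dmul a d b e K K' : 0 <= K -> 0 <= K' ->
  bounded_form K d -> bounded_form K' e ->
  bounded_form (K * nrm b + K' * nrm a) (dmul a d b e).
Proof.
move=> K0 K0' dK eK i L M; rewrite /dmul (le_trans (le_normcD _ _))// !mulrDl.
rewrite lerD//.
  rewrite (le_trans (dK _ _ _))// [leRHS](_ : _ = K * nrm L * (nrm b * nrm M)); last by ring.
  by rewrite ler_wpM2l ?ler_cstar_normM ?mulr_ge0 ?cstar_norm_ge0.
rewrite (le_trans (eK _ _ _))// ler_wpM2r ?cstar_norm_ge0//.
by rewrite -mulrA ler_wpM2l// mulrC ler_cstar_normM.
Qed.

Lemma dgraph_regular g a d : (forall x e, g x e -> regular_form e) ->
  dgraph g a d -> regular_form d.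
Proof.
move=> gr; elim=> {a d} [a d /gr//||z a d b e _ [db [K K0 dK]] _ [eb [K' K0' eK]]
    |a d b e _ [db [K K0 dK]] _ [eb [K' K0' eK]]].
- split; first exact: bilinear_dzero.
  by exists 0 => // i L M; rewrite /dzero Normc.normc0 !mul0r.
- split; first exact: bilinear_dlin.
  exists (Normc.normc z * K + K'); last exact: bounded_dlin.
  by rewrite addr_ge0// mulr_ge0// normc_ge0.
- split; first exact: bilinear_dmul.
  exists (K * nrm b + K' * nrm a); last exact: bounded_dmul.
  by rewrite addr_ge0// mulr_ge0// cstar_norm_ge0.
Qed.

Lemma dvar_regular j : regular_form (dvar j).
Proof.
split; first exact: bilinear_dvar.
exists 4 => // i L M; rewrite /dvar; case: ifP => _; last first.
  by rewrite Normc.normc0 !mulr_ge0 ?cstar_norm_ge0.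
have := state_bounded Hphi L; have := state_bounded Hphi M.
have := normc_ge0 (phi L); have := normc_ge0 (phi M).
rewrite Normc.normcM.
move: (nrm L) (nrm M) (Normc.normc _) (Normc.normc _) => l m p q.
nra.
Qed.

(** An induction over words, one letter at a time, in place of the induction over
    trees of products. *)
Lemma dgraph_left_ind g (S : A -> dform -> Prop) :
  (forall a d, S a d -> bilinear_form d) ->
  S 1 dzero ->
  (forall z a d b e, S a d -> S b e -> S (z *: a + b) (dlin z d e)) ->
  (forall a d b e, g a d -> S b e -> S (a * b) (dmul a d b e)) ->
  forall a d, dgraph g a d -> S a d.
Proof.
move=> Sb S1 Slin Sgen.
have key a d : dgraph g a d -> forall b e, S b e -> S (a * b) (dmul a d b e).
  elim=> {a d} [a d /Sgen//||z a d b e _ IHa _ IHb|a d b e _ IHa _ IHb] c f Sc.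
  - rewrite mul1r (_ : dmul _ _ _ _ = f)//.
    by apply/funext => i; apply/funext => L; apply/funext => M;
      rewrite /dmul /dzero add0r mulr1.
  - rewrite mulrDl -scalerAl.
    rewrite (_ : dmul _ _ _ _ = dlin z (dmul a d c f) (dmul b e c f)); first exact/Slin/IHb/Sc/IHa.
    apply/funext => i; apply/funext => L; apply/funext => M.
    rewrite /dmul /dlin mulrDr -scalerAr; have [fl _] := Sb _ _ Sc.
    by rewrite fl; ring.
  - rewrite -mulrA (_ : dmul _ _ _ _ = dmul a d (b * c) (dmul b e c f)).
      exact/IHa/IHb.
    apply/funext => i; apply/funext => L; apply/funext => M.
    by rewrite /dmul !mulrA addrA.
move=> a d /key/(_ _ _ S1); rewrite mulr1 (_ : dmul _ _ _ _ = d)//.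
by apply/funext => i; apply/funext => L; apply/funext => M;
  rewrite /dmul /dzero addr0 mul1r.
Qed.

Definition form_close (eps : R) d e : Prop :=
  forall i L M, Normc.normc (d i L M - e i L M) <= eps * nrm L * nrm M.

(** Limits of pairs, in norm for the element and uniformly on the unit balls for
    the derivatives.  Schwinger-Dyson equations survive such limits, and inverses
    are such limits of polynomials. *)
Definition gclosure G a d : Prop := regular_form d /\
  forall eps : R, 0 < eps -> exists b e, [/\ G b e, nrm (a - b) <= eps & form_close eps d e].

Lemma gclosure_sub G a d : regular_form d -> G a d -> gclosure G a d.
Proof.
move=> rd Gad; split=> // eps e0; exists a, d; split=> //.
  by rewrite subrr cstar_norm0 ltW.
by move=> i L M; rewrite subrr Normc.normc0 !mulr_ge0 ?cstar_norm_ge0 ?(ltW e0).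
Qed.

Lemma gclosure_dgraph g h a d : (forall x e, g x e -> regular_form e) ->
  (forall x e, h x e -> gclosure (dgraph g) x e) ->
  dgraph h a d -> gclosure (dgraph g) a d.
Proof.
move=> gr hg; elim=> {a d} [a d /hg//||z a d b e _ [rd IHa] _ [re IHb]
    |a d b e _ [rd IHa] _ [re IHb]].
- apply: gclosure_sub (dgraph1 g); apply: dgraph_regular gr _; exact: dgraph1.
- have [db [K K0 dK]] := rd; have [eb [K' K0' eK]] := re.
  split.
    split; first exact: bilinear_dlin.
    exists (Normc.normc z * K + K'); last exact: bounded_dlin.
    by rewrite addr_ge0// mulr_ge0// normc_ge0.
  move=> eps eps0; pose C := Normc.normc z + 1.
  have C0 : 0 < C by rewrite ltr_pwDr// normc_ge0.
  have C1 : Normc.normc z * (eps / C) + eps / C = eps.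
    by rewrite -{2}[eps / C]mul1r -mulrDl mulrC divfK// gt_eqF.
  have [a' [d' [Ga' aa' dd']]] := IHa _ (divr_gt0 eps0 C0).
  have [b' [e' [Gb' bb' ee']]] := IHb _ (divr_gt0 eps0 C0).
  exists (z *: a' + b'), (dlin z d' e'); split; first exact: dgraph_lin.
    rewrite opprD addrACA -scalerBr (le_trans (ler_cstar_normD _ _))//.
    by rewrite cstar_normZ -[leRHS]C1 lerD// ler_wpM2l// normc_ge0.
  move=> i L M; rewrite /dlin opprD addrACA -mulrBr (le_trans (le_normcD _ _))//.
  rewrite Normc.normcM -[X in X * _ * _]C1 !mulrDl lerD// -!mulrA.
  by rewrite ler_wpM2l ?normc_ge0// !mulrA dd'.
- have [db [K K0 dK]] := rd; have [eb [K' K0' eK]] := re.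
  split.
    split; first exact: bilinear_dmul.
    exists (K * nrm b + K' * nrm a); last exact: bounded_dmul.
    by rewrite addr_ge0// mulr_ge0// cstar_norm_ge0.
  move=> eps eps0; pose C := K + K' + nrm a + nrm b + 2.
  have a0 := cstar_norm_ge0 a; have b0 := cstar_norm_ge0 b.
  have C0 : 0 < C by rewrite /C; lra.
  pose del := Num.min 1 (eps / C).
  have del0 : 0 < del by rewrite lt_min ltr01 divr_gt0.
  have del1 : del <= 1 by rewrite ge_min lexx.
  have delC : del * C <= eps by rewrite -ler_pdivlMr// ge_min lexx orbT.
  have [a' [d' [Ga' aa' dd']]] := IHa _ del0.
  have [b' [e' [Gb' bb' ee']]] := IHb _ del0.
  have b'1 : nrm b' <= nrm b + 1.
    have -> : b' = b - (b - b') by rewrite subKr.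
    by rewrite (le_trans (ler_cstar_normB _ _))// lerD// (le_trans bb').
  have a'1 : nrm a' <= nrm a + 1.
    have -> : a' = a - (a - a') by rewrite subKr.
    by rewrite (le_trans (ler_cstar_normB _ _))// lerD// (le_trans aa').
  exists (a' * b'), (dmul a' d' b' e'); split; first exact: dgraph_mul.
    have -> : a * b - a' * b' = a * (b - b') + (a - a') * b'.
      by rewrite mulrBr mulrBl addrA subrK.
    apply: le_trans (ler_cstar_normD _ _) _; apply: le_trans _ delC.
    have := ler_cstar_normM a (b - b'); have := ler_cstar_normM (a - a') b'.
    have := cstar_norm_ge0 (a - a'); have := cstar_norm_ge0 (b - b').
    rewrite /C; move: (nrm (a * _)) (nrm ((a - a') * b')) aa' bb'.
    move: (nrm (a - a')) (nrm (b - b')) (nrm a) (nrm b) (nrm b') a0 b0 b'1 => *.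
    nra.
  move=> i L M; rewrite /dmul.
  have -> : d i L (b * M) + e i (L * a) M - (d' i L (b' * M) + e' i (L * a') M) =
    (d i L ((b - b') * M) + (d i L (b' * M) - d' i L (b' * M))) +
    (e i (L * (a - a')) M + (e i (L * a') M - e' i (L * a') M)).
    by rewrite mulrBl formBr// mulrBr formBl//; ring.
  have L0 := cstar_norm_ge0 L; have M0 := cstar_norm_ge0 M.
  have LM0 : 0 <= nrm L * nrm M by rewrite mulr_ge0.
  have t1 : Normc.normc (d i L ((b - b') * M)) <= K * del * (nrm L * nrm M).
    rewrite (le_trans (dK _ _ _))//.
    rewrite [leRHS](_ : _ = K * nrm L * (del * nrm M)); last by ring.
    rewrite ler_wpM2l ?mulr_ge0// (le_trans (ler_cstar_normM _ _))//.
    by rewrite ler_wpM2r.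
  have t2 : Normc.normc (d i L (b' * M) - d' i L (b' * M)) <=
      del * (nrm b + 1) * (nrm L * nrm M).
    rewrite (le_trans (dd' _ _ _))//.
    rewrite [leRHS](_ : _ = del * nrm L * ((nrm b + 1) * nrm M)); last by ring.
    rewrite ler_wpM2l ?mulr_ge0 ?(ltW del0)// (le_trans (ler_cstar_normM _ _))//.
    by rewrite ler_wpM2r.
  have t3 : Normc.normc (e i (L * (a - a')) M) <= K' * del * (nrm L * nrm M).
    rewrite (le_trans (eK _ _ _))//.
    rewrite [leRHS](_ : _ = K' * (nrm L * del) * nrm M); last by ring.
    rewrite ler_wpM2r// ler_wpM2l// (le_trans (ler_cstar_normM _ _))//.
    by rewrite ler_wpM2l.
  have t4 : Normc.normc (e i (L * a') M - e' i (L * a') M) <=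
      del * (nrm a + 1) * (nrm L * nrm M).
    rewrite (le_trans (ee' _ _ _))//.
    rewrite [leRHS](_ : _ = del * (nrm L * (nrm a + 1)) * nrm M); last by ring.
    rewrite ler_wpM2r// ler_wpM2l ?(ltW del0)// (le_trans (ler_cstar_normM _ _))//.
    by rewrite ler_wpM2l.
  apply: le_trans (le_normcD _ _) _.
  apply: le_trans (lerD (le_normcD _ _) (le_normcD _ _)) _.
  apply: le_trans (lerD (lerD t1 t2) (lerD t3 t4)) _.
  rewrite -!mulrDl -mulrA ler_wpM2r// (le_trans _ delC)//.
  by rewrite le_eqVlt; apply/orP; left; apply/eqP; rewrite /C; ring.
Qed.

(** The Schwinger-Dyson equations: they hold for all polynomials exactly when
    [xi] is the family of conjugate variables. *)
Definition conj_eq (xi : I -> A) a d : Prop := forall i, phi (xi i * a) = d i 1 1.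

Lemma conj_eq_lin xi z a d b e :
  conj_eq xi a d -> conj_eq xi b e -> conj_eq xi (z *: a + b) (dlin z d e).
Proof.
by move=> da eb i; rewrite mulrDr -scalerAr linearP /= da eb.
Qed.

Lemma normc_small_eq0 z (C : R) : (forall eps, 0 < eps -> Normc.normc z <= C * eps) -> z = 0.
Proof.
move=> h; apply: Normc.eq0_normc; apply/le_anti; rewrite normc_ge0 andbT.
apply/ler_addgt0Pr => eps e0; rewrite add0r.
have C1 : 0 < `|C| + 1 by rewrite ltr_pwDr.
rewrite (le_trans (h _ (divr_gt0 e0 C1)))// mulrCA ler_piMr ?(ltW e0)//.
by rewrite ler_pdivrMr// mul1r (le_trans (ler_norm C))// lerDl.
Qed.

Lemma conj_eq_closure (xi : I -> A) G a d : (forall b e, G b e -> conj_eq xi b e) ->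
  gclosure G a d -> conj_eq xi a d.
Proof.
move=> Gc [rd h] i; apply/eqP; rewrite -subr_eq0; apply/eqP.
apply: (@normc_small_eq0 _ (2 * nrm (xi i) + 1)) => eps e0.
have [b [e [Gb ab de]]] := h _ e0.
have -> : phi (xi i * a) - d i 1 1 = phi (xi i * (a - b)) - (d i 1 1 - e i 1 1).
  by rewrite mulrBr linearB /= (Gc _ _ Gb); ring.
rewrite (le_trans (le_normcD _ _))// normcN mulrDl mul1r lerD//.
  rewrite (le_trans (state_bounded Hphi _))// -mulrA ler_wpM2l//.
  by rewrite (le_trans (ler_cstar_normM _ _))// ler_wpM2l ?cstar_norm_ge0.
by have := de i 1 1; rewrite cstar_norm1 !mulr1.
Qed.

Fixpoint dpow (T : A) (dT : dform) n : dform :=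
  if n is k.+1 then dmul T dT (T ^+ k) (dpow T dT k) else dzero.

Lemma dgraph_pow g T dT n : dgraph g T dT -> dgraph g (T ^+ n) (dpow T dT n).
Proof.
move=> gT; elim: n => [|n IH]; first exact: dgraph1.
by rewrite exprS; exact: dgraph_mul.
Qed.

Lemma dpow_small T dT : regular_form dT -> nrm T < 1 ->
  forall eps : R, 0 < eps -> exists n, nrm (T ^+ n) <= eps /\ bounded_form eps (dpow T dT n).
Proof.
move=> [dTb [K K0 TK]] T1 eps e0; set q := nrm T in T1.
have q0 : 0 <= q := cstar_norm_ge0 T.
(* The derivative of [T^n] has [n] terms of size [q^(n - 1)]; replacing [q] by a
   larger [p < 1] absorbs the factor [n]. *)
pose p := (q + 1) / 2; have qp : q < p by rewrite /p; lra.
have p1 : p < 1 by rewrite /p; lra.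
have p0 : 0 <= p by rewrite /p; lra.
have pq : 0 < p - q by rewrite subr_gt0.
pose C := K / (p - q); have C0 : 0 <= C by rewrite divr_ge0// ltW.
have qpn n : q ^+ n <= p ^+ n by rewrite lerXn2r// ltW.
have bnd n : bounded_form (C * p ^+ n) (dpow T dT n).
  elim: n => [|n IH] i L M.
    rewrite (_ : dpow T dT 0 i L M = 0)// Normc.normc0 expr0 mulr1.
    by rewrite !mulr_ge0 ?invr_ge0 ?cstar_norm_ge0// ltW.
  have pn0 : 0 <= C * p ^+ n by rewrite mulr_ge0// exprn_ge0.
  rewrite (le_trans (bounded_dmul T (T ^+ n) K0 pn0 TK IH i L M))//.
  rewrite ler_wpM2r ?cstar_norm_ge0// ler_wpM2r ?cstar_norm_ge0//.
  rewrite (@le_trans _ _ (K * p ^+ n + C * p ^+ n * q))//.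
    by rewrite lerD2r ler_wpM2l// (le_trans (ler_cstar_normX _ _)).
  rewrite exprSr mulrA -subr_ge0 (_ : _ - _ = (C * (p - q) - K) * p ^+ n); last by ring.
  by rewrite /C divfK ?gt_eqF// subrr mul0r.
have C1 : 0 < C + 1 by rewrite ltr_pwDr.
have p1' : `|p| < 1 by rewrite ger0_norm.
have /cvgrPdist_lt/(_ _ (divr_gt0 e0 C1))[n _ /(_ n (leqnn n))] := cvg_expr p1'.
rewrite sub0r normrN ger0_norm ?exprn_ge0// ltr_pdivlMr// => pn; exists n; split.
  apply: le_trans (ler_cstar_normX _ _) _; apply: le_trans (qpn n) _.
  apply: le_trans (ltW pn); rewrite ler_peMr ?exprn_ge0//.
  by rewrite lerDr.
move=> i L M; rewrite (le_trans (bnd n i L M))//.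
rewrite ler_wpM2r ?cstar_norm_ge0// ler_wpM2r ?cstar_norm_ge0//.
rewrite (le_trans _ (ltW pn))// mulrC ler_wpM2l ?exprn_ge0//.
by rewrite lerDl.
Qed.

(** Meant for the case where [a - a * T ^+ n] is simpler than [a], such as a
    partial sum of the Neumann series or a multiple of a power of a variable. *)
Lemma gclosure_pow G a d T dT : regular_form d -> regular_form dT -> nrm T < 1 ->
  (forall n, G (a - a * T ^+ n)
     (fun i L M => d i L M - dmul a d (T ^+ n) (dpow T dT n) i L M)) ->
  gclosure G a d.
Proof.
move=> rd rT T1 Gn; split=> // eps e0.
have [db [K K0 dK]] := rd; have a0 := cstar_norm_ge0 a.
pose C := K + nrm a + 1; have C0 : 0 < C by rewrite /C; lra.
have [n [Tn Tb]] := dpow_small rT T1 (divr_gt0 e0 C0).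
have eC : C * (eps / C) = eps by rewrite mulrC divfK// gt_eqF.
have ec0 : 0 <= eps / C by rewrite divr_ge0// ltW.
exists (a - a * T ^+ n); eexists; split; first exact: Gn.
  rewrite subKr (le_trans (ler_cstar_normM _ _))// -[leRHS]eC.
  have := cstar_norm_ge0 (T ^+ n); move: Tn ec0; move: (eps / C) => t.
  by rewrite /C; move: (nrm (T ^+ n)) (nrm a) a0 => *; nra.
move=> i L M; rewrite subKr.
rewrite (le_trans (bounded_dmul a (T ^+ n) K0 ec0 dK Tb i L M))//.
rewrite ler_wpM2r ?cstar_norm_ge0// ler_wpM2r ?cstar_norm_ge0//.
rewrite -[leRHS]eC; have := cstar_norm_ge0 (T ^+ n).
move: Tn ec0; move: (eps / C) => t.
by rewrite /C; move: (nrm (T ^+ n)) (nrm a) a0 => *; nra.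
Qed.

Definition dinv x d : dform := fun i L M => - d i (L * x^-1) (x^-1 * M).

Lemma dinv_regular x d : regular_form d -> regular_form (dinv x d).
Proof.
move=> [db [K K0 dK]]; split.
  split=> i z L L' M; rewrite /dinv.
    by rewrite mulrDl -scalerAl formDl// formZl//; ring.
  by rewrite mulrDr -scalerAr formDr// formZr//; ring.
exists (K * nrm x^-1 ^+ 2); first by rewrite mulr_ge0// exprn_ge0// cstar_norm_ge0.
move=> i L M; rewrite /dinv normcN (le_trans (dK _ _ _))//.
have := ler_cstar_normM L x^-1; have := ler_cstar_normM x^-1 M.
have := cstar_norm_ge0 (L * x^-1); have := cstar_norm_ge0 (x^-1 * M).
have := cstar_norm_ge0 L; have := cstar_norm_ge0 M; have := cstar_norm_ge0 x^-1.
move: (nrm (L * x^-1)) (nrm (x^-1 * M)) (nrm L) (nrm M) (nrm x^-1) => l m n o p *.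
rewrite [leRHS](_ : _ = K * ((n * p) * (p * o))); last by ring.
by rewrite -mulrA ler_wpM2l// ler_pM.
Qed.

(** The Neumann series converges together with its derivatives, by the geometric
    decay of the powers of [1 - S / k]. *)
Lemma gclosure_inv g S dS (k : R) : (forall x e, g x e -> regular_form e) ->
  dgraph g S dS -> nrm (S - k%:C%:A) < k -> gclosure (dgraph g) S^-1 (dinv S dS).
Proof.
move=> gr gS Sk; have Su := unit_near_scalar Sk.
have k0 : 0 < k by rewrite (le_lt_trans _ Sk)// cstar_norm_ge0.
have rS := dgraph_regular gr gS; have Sb := rS.1.
pose c : R[i] := k^-1%:C.
have ck : c * k%:C = 1 by rewrite /c -rmorphM /= mulVf ?gt_eqF.
pose T : A := - c *: S + 1; pose dT := dlin (- c) dS dzero.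
have gT : dgraph g T dT by apply: dgraph_lin => //; exact: dgraph1.
have rT := dgraph_regular gr gT.
have T1 : nrm T < 1.
  have -> : T = - c *: (S - k%:C%:A).
    by rewrite scalerBr scalerA !mulNr ck scaleN1r opprK.
  rewrite scaleNr cstar_normN cstar_normZr ?invr_ge0 ?(ltW k0)//.
  by rewrite ltr_pdivrMl// mulr1.
set U := S^-1.
have US : U * S = 1 by exact: mulVr.
have T1c : 1 - T = c *: S by rewrite /T opprD addrCA subrr addr0 scaleNr opprK.
(* [U - U T^n] is the [n]-th partial sum of the Neumann series, and the
   derivatives agree as well. *)
apply: (gclosure_pow (dinv_regular S rS) rT T1) => n.
rewrite -/U; elim: n => [|n IH].
  rewrite expr0 mulr1 subrr.
  have -> : (fun i L M => dinv S dS i L M - dmul U (dinv S dS) 1 (dpow T dT 0) i L M) =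
     dlin (-1) dzero dzero.
    apply/funext => i; apply/funext => L; apply/funext => M.
    by rewrite /dmul /dlin /= /dzero mul1r; ring.
  have -> : 0 = (-1 : R[i]) *: (1 : A) + 1 by rewrite scaleN1r addNr.
  by apply: dgraph_lin; exact: dgraph1.
have -> : U - U * T ^+ n.+1 = c *: T ^+ n + (U - U * T ^+ n).
  have -> : U * T ^+ n.+1 = U * T ^+ n - c *: T ^+ n.
    rewrite exprS; have {1}-> : T = 1 - c *: S by rewrite -T1c subKr.
    by rewrite mulrBl mul1r mulrBr -scalerAl -scalerAr mulrA US mul1r.
  by rewrite opprB addrCA.
set D := (X in dgraph g _ X).
have -> : D = dlin c (dpow T dT n)
    (fun i L M => dinv S dS i L M - dmul U (dinv S dS) (T ^+ n) (dpow T dT n) i L M).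
  have dnb := (dgraph_regular gr (dgraph_pow n gT)).1.
  apply/funext => i; apply/funext => L; apply/funext => M.
  rewrite /D /dlin /dmul /= /dmul exprS.
  have -> : T * T ^+ n * M = T ^+ n * M - c *: (S * (T ^+ n * M)).
    by rewrite -mulrA scalerAl -T1c mulrBl mul1r subKr.
  have -> : L * U * T = L * U - c *: L.
    have -> : T = 1 - c *: S by rewrite -T1c subKr.
    by rewrite mulrBr mulr1 -scalerAr -mulrA US mulr1.
  rewrite /dinv mulrBr formBr// -scalerAr formZr// -/U [U * (S * _)]mulrA US mul1r.
  rewrite formBl// formZl// /dT /dlin /dzero; ring.
by apply: dgraph_lin IH; exact: dgraph_pow.
Qed.
End DerivationGraphs.

(** * Alternating words and the conjugate variables of a free family *)

Section GeneratedAlgebra.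
Variables (R : realType) (A : cstarAlgType R).
Implicit Types (x a b : A).

Lemma generated_algebra_unital x : unital_subalgebra (generated_algebra x).
Proof.
split=> [S [[S1 _ _] _] //|z a b ha hb S HS|a b ha hb S HS].
  by have [[_ Sl _] _] := HS; apply: Sl; [exact: ha|exact: hb].
by have [[_ _ Sm] _] := HS; apply: Sm; [exact: ha|exact: hb].
Qed.

Lemma generated_algebra_gen x : generated_algebra x x.
Proof. by move=> S [_]; apply. Qed.

Lemma generated_algebra_min x (S : set A) : unital_subalgebra S -> S x ->
  generated_algebra x `<=` S.
Proof. by move=> Su Sx a; apply; split=> // _ ->. Qed.

Lemma generated_algebra_lin x z a b :
  generated_algebra x a -> generated_algebra x b -> generated_algebra x (z *: a + b).
Proof. by have [_ + _] := generated_algebra_unital x; apply. Qed.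

Lemma generated_algebraM x a b :
  generated_algebra x a -> generated_algebra x b -> generated_algebra x (a * b).
Proof. by have [_ _] := generated_algebra_unital x; apply. Qed.

Lemma generated_algebra1 x : generated_algebra x 1.
Proof. by have [] := generated_algebra_unital x. Qed.

End GeneratedAlgebra.

Section AlternatingWords.
Variables (R : realType) (A : cstarAlgType R) (phi : {scalar A}).
Hypothesis phi1 : phi 1 = 1.
Variables (I : eqType) (B : I -> set A).
Hypothesis Bu : forall i, unital_subalgebra (B i).
Implicit Types (s t : seq (I * A)) (i j : I) (a b q : A).

Definition aprod s : A := \prod_(p <- s) p.2.

(** Products of centred elements whose neighbours come from different
    members of the family. *)
Fixpoint alternating s : Prop :=
  if s is p :: s' then
    [/\ B p.1 p.2, phi p.2 = 0, (if s' is q :: _ then p.1 <> q.1 else True)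
      & alternating s']
  else True.

Lemma alternatingP (p0 : I * A) s : alternating s ->
  (forall k, (k.+1 < size s)%N -> (nth p0 s k).1 <> (nth p0 s k.+1).1) /\
  (forall k, (k < size s)%N -> B (nth p0 s k).1 (nth p0 s k).2 /\ phi (nth p0 s k).2 = 0).
Proof.
elim: s => [|p s IH]; first by [].
case=> Bp pp ps /IH[h1 h2]; split.
  by case=> [|k]; [case: s ps {IH h1 h2}|exact: h1].
by case=> [|k]; [|exact: h2].
Qed.

Lemma alternating_eq0 s : free_subalgebras phi B -> alternating s -> s <> [::] ->
  phi (aprod s) = 0.
Proof.
case: s => // p0 s fr /(alternatingP p0)[h1 h2] _.
have := fr (size (p0 :: s)) (fun k => (nth p0 (p0 :: s) k).1)
  (fun k => (nth p0 (p0 :: s) k).2) isT h1 h2.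
by rewrite /aprod (big_nth p0) big_mkord.
Qed.

Lemma free_of_alternating :
  (forall s, alternating s -> s <> [::] -> phi (aprod s) = 0) ->
  free_subalgebras phi B.
Proof.
move=> h n i a n0 ii Ba; pose f k := (i k, a k).
have -> : \prod_(k < n) a k = aprod (map f (iota 0 n)).
  by rewrite /aprod big_map -(big_mkord xpredT a) /index_iota subn0.
apply: h; last by move=> /(congr1 size); rewrite size_map size_iota; case: n n0 {ii Ba}.
have : forall m k, (m + k <= n)%N -> alternating (map f (iota m k)).
  move=> m k; elim: k m => [//|k IH] m mk /=.
  have mn : (m < n)%N by apply: leq_trans mk; rewrite addnS ltnS leq_addr.
  have [Bm pm] := Ba _ mn; split=> //; last by apply: IH; rewrite addSnnS.
  case: k mk {IH} => [//|k] mk /=; apply: ii; apply: leq_trans mk.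
  by rewrite !addnS !ltnS leq_addr.
by move/(_ 0%N n); apply; rewrite add0n.
Qed.

Lemma alternating_catl s t : alternating (s ++ t) -> alternating s.
Proof.
elim: s => [//|p s IH] /= [Bp pp ps st]; split=> //; last exact: IH.
by case: s ps {IH st}.
Qed.

Lemma alternating_catr s t : alternating (s ++ t) -> alternating t.
Proof. by elim: s => [//|p s IH] /= [_ _ _ /IH]. Qed.

Lemma alternating_replace s t i a b : alternating (s ++ (i, a) :: t) ->
  B i b -> phi b = 0 -> alternating (rcons s (i, b)).
Proof.
move=> + Bb b0; elim: s => [|p s IH] /= [Bp pp ps st]; split=> //; last exact: IH.
by case: s ps {IH st}.
Qed.

Lemma aprod_rcons s i a : aprod (rcons s (i, a)) = aprod s * a.
Proof. by rewrite /aprod -cats1 big_cat big_seq1. Qed.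

Lemma aprod_cons i a s : aprod ((i, a) :: s) = a * aprod s.
Proof. by rewrite /aprod big_cons. Qed.

Definition center a : A := - phi a *: 1 + a.

Lemma center_eq0 a : phi (center a) = 0.
Proof. by rewrite /center linearP /= phi1 mulr1 addNr. Qed.

Lemma center_in i a : B i a -> B i (center a).
Proof. by have [B1 Bl _] := Bu i; move=> Ba; apply: Bl. Qed.

Lemma centerK a : a = center a + phi a *: 1.
Proof. by rewrite /center scaleNr addrAC addNr add0r. Qed.

Hypothesis fr : free_subalgebras phi B.

Lemma alternating_mulr s t i a q : alternating (s ++ (i, a) :: t) -> s <> [::] ->
  B i q -> phi (aprod s * q) = 0.
Proof.
move=> st s0 Bq; rewrite [q]centerK mulrDr -scalerAr mulr1.
rewrite linearD linearZ /= [phi (aprod s)]alternating_eq0//; last exact: alternating_catl st.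
rewrite mulr0 addr0 -(aprod_rcons s i); apply: alternating_eq0 => //; last by case: s {st s0}.
by apply: alternating_replace st _ _; [exact: center_in|exact: center_eq0].
Qed.

Lemma alternating_mull s i q : alternating s -> (if s is p :: _ then i <> p.1 else False) ->
  B i q -> phi (q * aprod s) = 0.
Proof.
move=> st s0 Bq; rewrite [q]centerK mulrDl -scalerAl mul1r linearD linearZ /=.
rewrite [phi (aprod s)]alternating_eq0//; last by case: s s0 {st}.
rewrite mulr0 addr0 -(aprod_cons i); apply: alternating_eq0 => //=.
by split=> //; [exact: center_in|exact: center_eq0|case: s st s0].
Qed.
End AlternatingWords.

Section FreeConjugate.
Variables (R : realType) (A : cstarAlgType R) (phi : {scalar A}).
Hypothesis Hphi : cstar_probability_space phi.
Variables (I : eqType) (x xi : I -> A).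
Local Notation B := (fun i => generated_algebra (x i)).
Hypothesis fr : free_subalgebras phi B.
Hypothesis xi_pow : forall i n, phi (xi i * x i ^+ n) =
  \sum_(j < n) (phi (x i ^+ j) : R[i]) * phi (x i ^+ (n - j.+1)).
Hypothesis xi_closure : forall i (eps : R), 0 < eps ->
  exists2 q, generated_algebra (x i) q & nrm (xi i - q) <= eps.

Local Notation dform := (dform A I).
Implicit Types (i j : I) (a b L M q : A) (d e : dform).

Definition single_gen i a d := a = x i /\ d = dvar phi i.
Definition family_gen a d := exists i, single_gen i a d.

Local Notation one i := (dgraph (single_gen i)).

Let Bu i : unital_subalgebra (B i) := generated_algebra_unital (x i).

Lemma single_gen_regular i a d : one i a d -> regular_form d.
Proof. by apply: dgraph_regular => _ _ [_ ->]; exact: dvar_regular. Qed.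

Lemma single_gen_alg i a d : one i a d -> B i a.
Proof.
elim=> {a d} [a d [-> _]||z a d b e _ ha _ hb|a d b e _ ha _ hb].
- exact: generated_algebra_gen.
- exact: generated_algebra1.
- exact: generated_algebra_lin.
- exact: generated_algebraM.
Qed.

Lemma single_gen_other i j a d L M : one i a d -> j != i -> d j L M = 0.
Proof.
move=> + /negbTE ji; move=> da; elim: da L M => {a d}
   [a d [_ ->]||z a d b e _ ha _ hb|a d b e _ ha _ hb] L M.
- by rewrite /dvar ji.
- by [].
- by rewrite /dlin ha hb mulr0 addr0.
- by rewrite /dmul ha hb addr0.
Qed.

(** Each derivative is a sum of tensors of polynomials in [x i]. *)
Lemma single_gen_left i j a d L M : one i a d -> (forall q, B i q -> phi (L * q) = 0) ->
  d j L M = 0.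
Proof.
move=> da; elim: da L M => {a d}
   [a d [_ ->]||z a d b e _ ha _ hb|a d b e da ha _ hb] L M Lq.
- rewrite /dvar; case: ifP => // _.
  by rewrite -[L]mulr1 Lq ?mul0r//; exact: generated_algebra1.
- by [].
- by rewrite /dlin ha ?hb ?mulr0 ?addr0.
- rewrite /dmul ha// hb ?addr0// => q Bq.
  rewrite -mulrA; apply: Lq; apply: generated_algebraM => //; exact: single_gen_alg da.
Qed.

Lemma single_gen_right i j a d L M : one i a d -> (forall q, B i q -> phi (q * M) = 0) ->
  d j L M = 0.
Proof.
move=> da; elim: da L M => {a d}
   [a d [_ ->]||z a d b e _ ha _ hb|a d b e _ ha db hb] L M Lq.
- rewrite /dvar; case: ifP => // _.
  by rewrite -[M]mul1r Lq ?mulr0//; exact: generated_algebra1.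
- by [].
- by rewrite /dlin ha ?hb ?mulr0 ?addr0.
- rewrite /dmul hb// ha ?addr0// => q Bq.
  rewrite mulrA; apply: Lq; apply: generated_algebraM => //; exact: single_gen_alg db.
Qed.

(** The induction multiplies by [x i] on the left, so the equations are carried
    for all [x i ^+ n * a] at once. *)
Lemma single_gen_conj i a d : one i a d -> phi (xi i * a) = d i 1 1.
Proof.
move=> da; suff [_ /(_ 0%N)] : bilinear_form d /\ forall n, phi (xi i * x i ^+ n * a) =
    \sum_(j < n) (phi (x i ^+ j) : R[i]) * phi (x i ^+ (n - j.+1) * a) + d i (x i ^+ n) 1.
  by rewrite big_ord0 add0r expr0 mulr1.
move: a d da; apply: dgraph_left_ind.
- by move=> a d [].
- split=> [|n]; first exact: bilinear_dzero.
  by rewrite mulr1 xi_pow addr0; apply: eq_bigr => j _; rewrite mulr1.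
- move=> z a d b e [db da] [eb ea]; split=> [|n]; first exact: bilinear_dlin.
  rewrite mulrDr -scalerAr linearP /= da ea /dlin mulrDr addrACA; congr (_ + _).
  rewrite mulr_sumr -big_split; apply: eq_bigr => j _ /=.
  by rewrite mulrDr -scalerAr linearP /=; ring.
- move=> a d b e [-> ->] [eb ea]; split=> [|n].
    by apply: bilinear_dmul => //; exact: bilinear_dvar.
  rewrite -mulrA (mulrA _ (x i) b) -exprSr mulrA ea big_ord_recr /=.
  rewrite /dmul /dvar eqxx subnn expr0 mul1r mulr1 -exprSr addrA; congr (_ + _ + _).
  by apply: eq_bigr => j _; rewrite mulrA -exprSr subSn.
Qed.

Lemma xi_limit i b : (forall q, B i q -> phi (q * b) = 0) -> phi (xi i * b) = 0.
Proof.
move=> h; apply: (@normc_small_eq0 _ _ (2 * nrm b)) => eps /(xi_closure i)[q Bq xq].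
rewrite -[xi i](subrK q) mulrDl linearD /= (h q Bq) addr0.
rewrite (le_trans (state_bounded Hphi _))// -mulrA ler_wpM2l// mulrC.
by rewrite (le_trans (ler_cstar_normM _ _))// ler_wpM2r ?cstar_norm_ge0.
Qed.

Implicit Types (s : seq (I * A * dform)).

(** The letters of a word carry their one-variable derivatives. *)
Definition wprod s : A := aprod (map fst s).

Fixpoint wder s : dform :=
  if s is (i, a, d) :: s' then dmul a d (wprod s') (wder s') else @dzero R A I.

Fixpoint wdgraph s : Prop :=
  if s is (i, a, d) :: s' then one i a d /\ wdgraph s' else True.

Definition cword s : Prop := alternating phi B (map fst s) /\ wdgraph s.

Lemma wprod_cons i a d s : wprod ((i, a, d) :: s) = a * wprod s.
Proof. by rewrite /wprod /= aprod_cons. Qed.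

Lemma wder_bilinear s : wdgraph s -> bilinear_form (wder s).
Proof.
elim: s => [_|[[i a] d] s IH /= [da ds]]; first exact: bilinear_dzero.
by apply: bilinear_dmul; [exact: (single_gen_regular da).1|exact: IH].
Qed.

Lemma wder_left0 (t : seq (I * A)) s j : alternating phi B (t ++ map fst s) -> t <> [::] ->
  wdgraph s -> wder s j (aprod t) 1 = 0.
Proof.
elim: s t => [//|[[i a] d] s IH] t /= ts t0 [da ds].
rewrite /dmul (single_gen_left _ _ da) ?add0r.
  rewrite -(aprod_rcons _ i); apply: IH => //; first by rewrite cat_rcons.
  by case: t {ts t0}.
by move=> q Bq; exact: (alternating_mulr (state1 Hphi) Bu fr ts t0 Bq).
Qed.

(** On an alternating word of length at least two both sides of the
    Schwinger-Dyson equation vanish, because of freeness; words of length one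
    are the one-variable equations. *)
Lemma cword_conj s : cword s -> conj_eq phi xi (wprod s) (wder s).
Proof.
move=> [als ds] j; case: s als ds => [_ _|[[i a] d] s als [da ds]].
  by rewrite /wprod /aprod big_nil -(expr0 (x j)) xi_pow big_ord0.
rewrite wprod_cons /= /dmul mul1r mulr1.
have -> : wder s j a 1 = 0.
  by have := @wder_left0 [:: (i, a)] s j als; rewrite /aprod big_seq1; apply.
rewrite addr0; have [_ a0 is_ als'] := als.
have Ba := single_gen_alg da.
case: s als als' is_ ds => [|[[k b] e] s] als als' ik ds.
  rewrite /wprod /aprod big_nil mulr1.
  have [->|ji] := eqVneq j i; first exact: single_gen_conj.
  rewrite (single_gen_other _ _ da)//; apply: xi_limit => q Bq.
  have := @alternating_mull _ _ _ (state1 Hphi) _ B Bu fr [:: (i, a)] j q als.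
  by rewrite /aprod big_seq1; apply=> //; exact/eqP.
have altail : alternating phi B (map fst ((k, b, e) :: s)) by exact: als'.
rewrite (single_gen_right _ _ da); last first.
  by move=> q Bq; exact: (alternating_mull (state1 Hphi) Bu fr altail ik Bq).
apply: xi_limit => q Bq; have [ji|ji] := eqVneq j i.
  rewrite mulrA; apply: (alternating_mull (state1 Hphi) Bu fr altail ik).
  by apply: generated_algebraM => //; rewrite -ji.
rewrite -(aprod_cons i); apply: (alternating_mull (state1 Hphi) Bu fr als _ Bq).
exact/eqP.
Qed.

Inductive wspan : A -> dform -> Prop :=
| wspan_word s : cword s -> wspan (wprod s) (wder s)
| wspan_lin z a d b e : wspan a d -> wspan b e -> wspan (z *: a + b) (dlin z d e).

Lemma wspan_bilinear a d : wspan a d -> bilinear_form d.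
Proof.
elim=> {a d} [s [_ ds]|z a d b e _ da _ eb]; first exact: wder_bilinear.
exact: bilinear_dlin.
Qed.

Lemma wspan_conj a d : wspan a d -> conj_eq phi xi a d.
Proof.
by elim=> {a d} [s /cword_conj//|z a d b e _ da _ eb]; exact: conj_eq_lin.
Qed.

Definition dcenter a d : dform := dlin (- phi a) (@dzero R A I) d.

Lemma one_center i a d : one i a d -> one i (center phi a) (dcenter a d).
Proof. by move=> da; apply: dgraph_lin => //; exact: dgraph1. Qed.

Lemma wspan_cons i a d s : wdgraph s -> one i a d ->
  (if s is p :: _ then i <> p.1.1 else True) -> cword s ->
  wspan (a * wprod s) (dmul a d (wprod s) (wder s)).
Proof.
move=> ds da is_ cs; pose t := (i, center phi a, dcenter a d) :: s.
have ct : cword t.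
  split; last by split=> //; exact: one_center.
  split; rewrite /=.
  - exact: single_gen_alg (one_center da).
  - by apply: center_eq0; exact: state1.
  - by case: s is_ {ds cs t}.
  - exact: cs.1.
have -> : a * wprod s = phi a *: wprod s + wprod t.
  by rewrite wprod_cons {1}[a](centerK phi) mulrDl -scalerAl mul1r addrC.
have -> : dmul a d (wprod s) (wder s) = dlin (phi a) (wder s) (wder t).
  apply/funext => j; apply/funext => L; apply/funext => M.
  rewrite /dlin /dmul /= /dmul /dcenter /dlin /dzero /center.
  have b := wder_bilinear ds.
  by rewrite mulrDr -scalerAr mulr1 formDl// formZl//; ring.
by apply: wspan_lin; exact: wspan_word.
Qed.

(** A new letter either starts a new syllable or merges with the first one; in
    both cases centring it produces two centred words. *)
Lemma wspan_mull a d b e : family_gen a d -> wspan b e -> wspan (a * b) (dmul a d b e).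
Proof.
move=> [i ga] be.
have da : one i a d by exact: dgraph_gen.
elim: be => {b e} [s [als ds]|z b d' c e hb IHb hc IHc].
  case: s als ds => [|[[j b] e] s] als ds.
    by apply: (@wspan_cons i a d [::]); rewrite ?ga.
  have [ij|/eqP ij] := eqVneq i j; last by apply: (@wspan_cons i a d ((j, b, e) :: s)).
  have [db ds'] := ds; rewrite -ij in db; rewrite wprod_cons mulrA.
  have -> : dmul a d (b * wprod s) (wder ((j, b, e) :: s)) =
      dmul (a * b) (dmul a d b e) (wprod s) (wder s).
    apply/funext => k; apply/funext => L; apply/funext => M.
    by rewrite /= /dmul !mulrA addrA.
  have [_ _ js als'] := als.
  have cs : cword s by split.
  have is_ : if s is p :: _ then i <> p.1.1 else True.
    by rewrite ij; case: s js {als ds ds' als' cs}.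
  apply: (@wspan_cons i) => //; first exact: dgraph_mul.
  by case: s is_ {als ds ds' als' cs js}.
rewrite mulrDr -scalerAr (_ : dmul _ _ _ _ = dlin z (dmul a d b d') (dmul a d c e)).
  exact: wspan_lin.
have [_ dr] := (single_gen_regular da).1.
apply/funext => k; apply/funext => L; apply/funext => M.
by rewrite /dlin /dmul mulrDl -scalerAl dr; ring.
Qed.

(** Freeness turns one-variable conjugate variables into partial ones, because
    centred alternating words span all polynomials. *)
Lemma free_conj a d : dgraph family_gen a d -> conj_eq phi xi a d.
Proof.
move=> gad; apply: wspan_conj; move: a d gad; apply: dgraph_left_ind.
- exact: wspan_bilinear.
- by have := @wspan_word [::] (conj Logic.I Logic.I); rewrite /wprod /aprod big_nil.
- exact: wspan_lin.
- exact: wspan_mull.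
Qed.
End FreeConjugate.

(** * Freeness from the liberation derivation *)

Section DerivationCriterion.
Variables (R : realType) (A : cstarAlgType R) (phi : {scalar A}).
Hypothesis phi1 : phi 1 = 1.
Hypothesis tr : forall a b : A, phi (a * b) = phi (b * a).
Variables (U V : A).
Local Notation B := (fun b : bool => if b then generated_algebra U else generated_algebra V).
Local Notation word := (seq (bool * A)).
Implicit Types (s t : word) (a b L M : A).

(** The value at [L, M] of the derivation with [U |-> U (x) 1 - 1 (x) U] and
    [V |-> 0] on a word, [true] marking the letters from the algebra of [U]. *)
Fixpoint liberation s L M : R[i] :=
  if s is (b, a) :: s' then
    (if b then phi (L * a) * phi (aprod s' * M) - phi L * phi (a * aprod s' * M) else 0)
    + liberation s' (L * a) M
  else 0.

Let Bu (c : bool) : unital_subalgebra (B c).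
Proof. by case: c; exact: generated_algebra_unital. Qed.

(** Every term contains the value of [phi] at a shorter centred word. *)
Lemma liberation_tail s t : alternating phi B (s ++ t) -> s <> [::] ->
  (forall u, (size u < size (s ++ t))%N -> alternating phi B u -> u <> [::] ->
     phi (aprod u) = 0) ->
  (if t is p :: t' then (last p t').1 = false else True) ->
  liberation t (aprod s) 1 = 0.
Proof.
elim: t s => [//|[b a] t IHt] s st s0 IH lt /=.
rewrite -(aprod_rcons s b) IHt ?cat_rcons//; last 2 first.
- by case: s {st s0 IH}.
- by case: t lt {IHt st IH}.
rewrite addr0; case: b st IH lt => // st IH lt.
have t0 : t <> [::] by case: t lt {IHt st IH}.
have -> : phi (aprod (rcons s (true, a))) = 0.
  apply: IH; last by case: s {st s0}.
    by rewrite size_rcons size_cat /= addnS ltnS -addn1 leq_add2l lt0n size_eq0; apply/eqP.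
  by apply: (@alternating_catl _ _ _ _ B _ t); rewrite cat_rcons.
have -> : phi (aprod s) = 0.
  apply: IH => //; last exact: alternating_catl st.
  by rewrite size_cat /= -addn1 leq_add2l.
by rewrite !mul0r subrr.
Qed.

(** Voiculescu's criterion.  On a centred alternating word that begins in the
    algebra of [U] and ends in that of [V], the derivation evaluates to minus the
    value of [phi], because the other terms contain shorter words; traciality
    reduces the remaining words to this case or to shorter ones. *)
Lemma free_of_liberation :
  (forall s, (forall k, (k < size s)%N -> B (nth (true, 0) s k).1 (nth (true, 0) s k).2) ->
     liberation s 1 1 = 0) ->
  free_elements phi U V.
Proof.
move=> lib0; apply: free_of_alternating => s; have [n] := ubnP (size s).
elim: n s => // n IHn s; rewrite ltnS => sn als s0.
have IH u : (size u < size s)%N -> alternating phi B u -> u <> [::] -> phi (aprod u) = 0.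
  by move=> us; apply: IHn; apply: leq_trans sn.
have open_case a t : size t = (size s).-1 -> t <> [::] -> alternating phi B ((true, a) :: t) ->
    (last (true, a) t).1 = false -> phi (a * aprod t) = 0.
  move=> ts t0 alt lt; have s1 : (0 < size s)%N by case: s s0 {als sn IH ts}.
  have a0 : phi a = 0 by case: alt.
  have e := @liberation_tail [:: (true, a)] t alt _ _ _.
  have := lib0 ((true, a) :: t); rewrite /= mul1r mulr1 a0 mul0r add0r phi1 mul1r mulr1.
  move: e; rewrite /aprod big_seq1 => ->//; rewrite ?addr0.
  - move=> h; apply/eqP; rewrite -oppr_eq0; apply/eqP; apply: h => k kt.
    by have [_ /(_ k kt)[]] := alternatingP (true, 0) alt.
  - by move=> u /=; rewrite ts prednK//; exact: IH.
  - by case: (t) t0 lt.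
case: s als s0 sn IH open_case => // [[b a] s] als _ sn IH open_case.
case/lastP: s als sn IH open_case => [|s [c d]] als sn IH open_case.
  by case: als => _ a0 _ _; rewrite /aprod big_seq1.
have [Ba a0 hd als1] := als; rewrite aprod_cons aprod_rcons.
have {}a0 : phi a = 0 := a0.
have als' : alternating phi B (s ++ [:: (c, d)]) by rewrite cats1; exact: als1.
have Bd : B c d /\ phi d = 0 by case: (alternating_catr als').
have als_s : alternating phi B s := alternating_catl als'.
clear als1.
have lastc : (if s is p :: s' then (last p s').1 <> c else True).
  case: s als' {als sn IH open_case hd als_s} => // p s.
  elim: s p => [p [_ _ + _] //|q s IH' p [_ _ _ alq]] /=.
  exact: IH'.
case: c d Bd lastc als hd als' open_case sn IH => d [Bd d0] lastc als hd als' open_case sn IH;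
  case: b Ba als hd open_case sn IH => Ba als hd open_case sn IH.
- case: s hd lastc als_s als als' open_case sn IH 
    => [hd|p s hd lastc als_s als als' open_case sn IH].
    by case: hd.
  rewrite mulrA tr mulrA; set w := aprod _.
  rewrite [d * a](centerK phi) mulrDl -scalerAl mul1r linearD linearZ /=.
  rewrite [phi w]IH//; last by rewrite /= size_rcons ltnS leqW.
  rewrite mulr0 addr0 -(aprod_cons true) IH//.
    by rewrite /= size_rcons.
  split => //; last exact: center_eq0.
  by apply: (@center_in _ _ _ _ B Bu true); exact: generated_algebraM Bd Ba.
  
- rewrite mulrA tr; rewrite -(aprod_cons false a s).
  apply: open_case => //; first by rewrite /= size_rcons.
    have al1 : alternating phi B ((false, a) :: s).
      by apply: (@alternating_catl _ _ _ _ B _ [:: (true, d)]); rewrite cats1; exact: als.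
    by split.
  by case: s lastc {hd als als' sn IH als_s} => //= p s; case: (last p s).1.
- rewrite -(aprod_rcons s false d); apply: open_case => //.
    by case: s {lastc als hd als' sn IH als_s}.
  by rewrite last_rcons.
- case: s hd lastc als_s als als' open_case sn IH 
    => [hd|p s hd lastc als_s als als' open_case sn IH].
    by case: hd.
  rewrite mulrA tr mulrA; set w := aprod _.
  rewrite [d * a](centerK phi) mulrDl -scalerAl mul1r linearD linearZ /=.
  rewrite [phi w]IH//; last by rewrite /= size_rcons ltnS leqW.
  rewrite mulr0 addr0 -(aprod_cons false) IH//.
    by rewrite /= size_rcons.
  split => //; last exact: center_eq0.
  by apply: (@center_in _ _ _ _ B Bu false); exact: generated_algebraM Bd Ba.
Qed.
End DerivationCriterion.

(** * The Matsumoto-Yor change of variables *)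

Section MatsumotoYorDerivation.
Variables (R : realType) (A : cstarAlgType R) (phi : {scalar A}).
Hypothesis Hphi : cstar_probability_space phi.
Variables (X Y : A) (al be l : R[i]).
Hypotheses (Xu : X \is a GRing.unit) (Yu : Y \is a GRing.unit)
  (Su : X + Y \is a GRing.unit).
Local Notation dform := (dform A bool).
Implicit Types (a b L M P : A) (d e : dform).

Let S : A := X + Y.
Let U : A := S^-1.
Let V : A := X^-1 - U.

Definition pair_var (b : bool) : A := if b then X else Y.

Definition gig_poisson_conj (b : bool) : A :=
  if b then al *: 1 + (l + 2) *: X^-1 - be *: X^-1 ^+ 2 else al *: 1 - l *: Y^-1.

(** Besides the two variables, the inverses that occur in [U] and [V] are
    generators, with the derivative of an inverse. *)
Definition rational_gen a d : Prop :=
  [\/ a = X /\ d = dvar phi true, a = Y /\ d = dvar phi false,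
      a = X^-1 /\ d = dinv X (dvar phi true) |
      a = (X + Y)^-1 /\ d = dinv (X + Y) (dlin 1 (dvar phi true) (dvar phi false))].

Hypothesis conj_rat : forall a d, dgraph rational_gen a d -> conj_eq phi gig_poisson_conj a d.

Let tr a b : phi (a * b) = phi (b * a). Proof. exact: state_tracial. Qed.

(** The derivation with [U |-> U (x) 1 - 1 (x) U] and [V |-> 0], written in the
    variables [X] and [Y]: it maps [X] to [X (x) U X - X U (x) X] and [X + Y]
    to [(X + Y) (x) 1 - 1 (x) (X + Y)]. *)
Definition liberation_form d L M : R[i] :=
  (d true (X * L) (M * (U * X)) - d true (X * U * L) (M * X)) +
  (d false (S * L) M - d false L (M * S)) -
  (d false (X * L) (M * (U * X)) - d false (X * U * L) (M * X)).

Lemma liberation_form_mul a d b e L M :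
  liberation_form (dmul a d b e) L M = liberation_form d L (b * M) + liberation_form e (L * a) M.
Proof. by rewrite /liberation_form /dmul !mulrA; ring. Qed.

Lemma liberation_form_lin z d e L M :
  liberation_form (dlin z d e) L M = z * liberation_form d L M + liberation_form e L M.
Proof. by rewrite /liberation_form /dlin; ring. Qed.

Let gX : dgraph rational_gen X (dvar phi true).
Proof. by apply: dgraph_gen; constructor 1. Qed.
Let gY : dgraph rational_gen Y (dvar phi false).
Proof. by apply: dgraph_gen; constructor 2. Qed.
Let gZ : dgraph rational_gen X^-1 (dinv X (dvar phi true)).
Proof. by apply: dgraph_gen; constructor 3. Qed.
Let gU : dgraph rational_gen U (dinv S (dlin 1 (dvar phi true) (dvar phi false))).
Proof. by apply: dgraph_gen; constructor 4. Qed.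
Let gS : dgraph rational_gen S (dlin 1 (dvar phi true) (dvar phi false)).
Proof. by rewrite /S -[X in X + _]scale1r; exact: dgraph_lin. Qed.

Let US : U * S = 1. Proof. exact: mulVr. Qed.
Let SU : S * U = 1. Proof. exact: mulrV. Qed.

(** Inserting [a (x) b] into the derivative of [P] gives the middle term of the
    derivative of [a P b]; the Schwinger-Dyson equation evaluates it. *)
Lemma conj_sandwich i a da P d b db :
  dgraph rational_gen a da -> dgraph rational_gen P d -> dgraph rational_gen b db ->
  phi (P * (b * gig_poisson_conj i * a)) = da i 1 (P * b) + d i a b + db i (a * P) 1.
Proof.
move=> ga gP gb; have := conj_rat (dgraph_mul (dgraph_mul ga gP) gb) i.
rewrite /dmul !mulr1 !mul1r => <-.
by rewrite -(mulrA b) mulrA tr !mulrA.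
Qed.

(** The core of the theorem: with [G = X Y^-1 X], the two factorisations
    [X + G = (X + Y) Y^-1 X = X Y^-1 (X + Y)] reduce the commutator of [U] with
    [X (xi_X - xi_Y) X - 2 X] to one of [X] with [Y^-1], which the commutator of
    [xi_Y] with [X + Y] cancels. *)
Lemma gig_poisson_conj_comm :
  U * X * gig_poisson_conj true * X - X * gig_poisson_conj true * (X * U)
  + (gig_poisson_conj false * S - S * gig_poisson_conj false)
  - (U * X * gig_poisson_conj false * X - X * gig_poisson_conj false * (X * U))
  = 2 *: (U * X - X * U).
Proof.
have XX : X * gig_poisson_conj true * X = al *: X ^+ 2 + (l + 2) *: X - be *: 1.
  rewrite /gig_poisson_conj mulrBr mulrDr mulrBl mulrDl -!scalerAr -!scalerAl mulr1.
  by rewrite divrr// mul1r expr2 mulrA divrr// mul1r mulVr.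
pose G := X * Y^-1 * X.
have XY : X * gig_poisson_conj false * X = al *: X ^+ 2 - l *: G.
  by rewrite /gig_poisson_conj mulrBr mulrBl -!scalerAr -!scalerAl mulr1.
have SY : gig_poisson_conj false * S - S * gig_poisson_conj false = l *: (S * Y^-1 - Y^-1 * S).
  rewrite /gig_poisson_conj mulrBl mulrBr -!scalerAl -!scalerAr mul1r mulr1 opprB.
  by rewrite addrC addrA subrK -scalerBr.
have e1 : X + G = S * (Y^-1 * X).
  by rewrite /S mulrDl (mulrA Y) mulrV// mul1r mulrA addrC.
have e2 : X + G = X * Y^-1 * S.
  by rewrite /S mulrDr -[_ * Y]mulrA mulVr// mulr1 addrC.
have c1 : U * (X + G) = Y^-1 * X by rewrite e1 mulrA US mul1r.
have c2 : (X + G) * U = X * Y^-1 by rewrite e2 -mulrA SU mulr1.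
have sY : S * Y^-1 - Y^-1 * S = X * Y^-1 - Y^-1 * X.
  rewrite /S mulrDl mulrDr mulrV// mulVr// opprD addrACA.
  by rewrite subrr addr0.
have lX : (l + 2) *: X = l *: X + 2 *: X by exact: scalerDl.
have K : X * gig_poisson_conj true * X - X * gig_poisson_conj false * X =
    l *: (X + G) + (2 *: X - be *: 1).
  have gen (p t b g : A) : (p + t - b) - (p - g) = g + t - b.
    by rewrite opprB [LHS]addrC !addrA subrK.
  rewrite XX XY gen lX scalerDr !addrA.
  by rewrite [l *: G + _]addrC.
rewrite addrAC.
have -> : U * X * gig_poisson_conj true * X - X * gig_poisson_conj true * (X * U) -
    (U * X * gig_poisson_conj false * X - X * gig_poisson_conj false * (X * U)) =
    U * (X * gig_poisson_conj true * X - X * gig_poisson_conj false * X) -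
    (X * gig_poisson_conj true * X - X * gig_poisson_conj false * X) * U.
  have gen (T F : A) : U * T - T * U - (U * F - F * U) = U * (T - F) - (T - F) * U.
    rewrite mulrBr mulrBl !opprB addrACA [RHS]addrACA; congr (_ + _).
    exact: addrC.
  by rewrite -gen !mulrA.
rewrite K SY sY (mulrDr U) (mulrDl _ _ U) -scalerAr -scalerAl c1 c2 opprD.
have z (a b : A) : a - b + (b - a) = 0 by rewrite addrA subrK subrr.
rewrite addrACA -scalerBr addrAC -scalerDr z scaler0 add0r.
rewrite (mulrBr U) (mulrBl U) -!scalerAr -!scalerAl mulr1 mul1r.
by rewrite opprB addrA subrK scalerBr.
Qed.

(** Six Schwinger-Dyson equations turn the derivation into [phi (P * W)], where
    [W] vanishes by the commutator identity. *)
Lemma liberation_form_rat P d : dgraph rational_gen P d -> liberation_form d 1 1 = 0.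
Proof.
move=> gP; have g1 := dgraph1 rational_gen.
have gUX := dgraph_mul gU gX; have gXU := dgraph_mul gX gU.
have phi1 := state1 Hphi.
have e1 := conj_sandwich true gX gP gUX.
have e2 := conj_sandwich true gXU gP gX.
have e3 := conj_sandwich false gS gP g1.
have e4 := conj_sandwich false g1 gP gS.
have e5 := conj_sandwich false gX gP gUX.
have e6 := conj_sandwich false gXU gP gX.
have w : (phi (P * (U * X * gig_poisson_conj true * X))
            - phi (P * (X * gig_poisson_conj true * (X * U))))
  + (phi (P * (gig_poisson_conj false * S)) - phi (P * (S * gig_poisson_conj false)))
  - (phi (P * (U * X * gig_poisson_conj false * X))
     - phi (P * (X * gig_poisson_conj false * (X * U))))
  = 2 * (phi (P * (U * X)) - phi (P * (X * U))) :> R[i].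
  have gen (T1 T2 T3 T4 T5 T6 : A) :
      phi (P * (T1 - T2 + (T3 - T4) - (T5 - T6))) =
      (phi (P * T1) - phi (P * T2)) + (phi (P * T3) - phi (P * T4))
      - (phi (P * T5) - phi (P * T6)) :> R[i].
    by rewrite !(mulrBr, mulrDr) !linearB /= linearD /= !linearB.
  by rewrite -gen gig_poisson_conj_comm -scalerAr linearZ /= mulrBr linearB.
move: e1 e2 e3 e4 e5 e6 w; move: (gig_poisson_conj true) (gig_poisson_conj false) => xX xY.
rewrite /liberation_form /dmul /dinv /dlin /dvar /dzero /= -/U.
rewrite !(mulr1, mul1r, mul0r, mulr0, add0r, addr0, phi1).
have t1 : phi (X * P * U) = phi (P * (U * X)) by rewrite -mulrA tr mulrA.
have t2 : phi (U * (P * X)) = phi (P * (X * U)) by rewrite tr mulrA.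
have t3 : phi (X * U * P) = phi (P * (X * U)) by rewrite tr.
rewrite t1 t2 t3 [phi (X * U)]tr.
move: (phi (P * (U * X))) (phi (P * (X * U))) (phi (U * X)) => p q r.
move: (d true X (U * X)) (d true (X * U) X) (d false S 1) (d false 1 S)
  (d false X (U * X)) (d false (X * U) X) => d1 d2 d3 d4 d5 d6.
move=> -> -> -> -> -> -> w; transitivity (2 * (p - q) - 2 * (p - q)); last by rewrite subrr.
by rewrite -{1}w; ring.
Qed.

(** The derivation as a relation, since its value may depend on the rational
    expression chosen for [a]. *)
Definition has_liberation a (t : A -> A -> R[i]) : Prop :=
  exists2 d, dgraph rational_gen a d & forall L M, liberation_form d L M = t L M.

Lemma has_liberation_lin z a t b u : has_liberation a t -> has_liberation b u ->
  has_liberation (z *: a + b) (fun L M => z * t L M + u L M).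
Proof.
move=> [d ga ht] [e gb hu]; exists (dlin z d e); first exact: dgraph_lin.
by move=> L M; rewrite liberation_form_lin ht hu.
Qed.

Lemma has_liberation_mul a t b u : has_liberation a t -> has_liberation b u ->
  has_liberation (a * b) (fun L M => t L (b * M) + u (L * a) M).
Proof.
move=> [d ga ht] [e gb hu]; exists (dmul a d b e); first exact: dgraph_mul.
by move=> L M; rewrite liberation_form_mul ht hu.
Qed.

Lemma has_liberation1 : has_liberation 1 (fun _ _ => 0).
Proof.
exists (@dzero R A bool); first exact: dgraph1.
by move=> L M; rewrite /liberation_form /dzero; ring.
Qed.

Lemma has_liberationU : has_liberation U (fun L M => phi (L * U) * phi M - phi L * phi (U * M)).
Proof.
exists (dinv S (dlin 1 (dvar phi true) (dvar phi false))) => // L M.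
rewrite /liberation_form /dinv /dlin /dvar /= -/U !(mulr0, addr0, add0r, mul1r).
have -> : phi (S * L * U) = phi L by rewrite -mulrA tr -mulrA US mulr1.
have -> : phi (U * (M * S)) = phi M by rewrite tr -mulrA SU mulr1.
by ring.
Qed.

Lemma has_liberationZ : has_liberation X^-1 (fun L M => phi (L * U) * phi M - phi L * phi (U * M)).
Proof.
exists (dinv X (dvar phi true)) => // L M.
rewrite /liberation_form /dinv /dlin /dvar /=.
have -> : phi (X * L * X^-1) = phi L by rewrite -mulrA tr -mulrA mulVr ?mulr1.
have -> : phi (X^-1 * (M * X)) = phi M by rewrite tr -mulrA divrr ?mulr1.
have -> : phi (X^-1 * (M * (U * X))) = phi (U * M).
  by rewrite [LHS]tr -!mulrA divrr// mulr1 [LHS]tr.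
have -> : phi (X * U * L * X^-1) = phi (L * U).
  by rewrite [LHS]tr !mulrA mulVr// mul1r [LHS]tr.
by ring.
Qed.

(** [V] is killed because [X^-1 = U + V] and [U] have the same derivative. *)
Lemma has_liberationV : has_liberation V (fun _ _ => 0).
Proof.
have [d g h] := has_liberation_lin (-1) has_liberationU has_liberationZ.
exists d; last by move=> L M; rewrite h; ring.
by rewrite /V addrC -scaleN1r.
Qed.

Lemma has_liberation_eq a t u : (forall L M, t L M = u L M) ->
  has_liberation a t -> has_liberation a u.
Proof. by move=> tu [d ga h]; exists d => // L M; rewrite h. Qed.

Lemma generated_has_liberU a : generated_algebra U a ->
  has_liberation a (fun L M => phi (L * a) * phi M - phi L * phi (a * M)).
Proof.
pose t a L M := phi (L * a) * phi M - phi L * phi (a * M) : R[i].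
apply: (@generated_algebra_min _ _ _ (fun a => has_liberation a (t a)));
  last exact: has_liberationU.
rewrite /t; split=> [|z b c hb hc|b c hb hc] /=.
- by apply: has_liberation_eq has_liberation1 => L M; rewrite mulr1 mul1r subrr.
- apply: has_liberation_eq (has_liberation_lin z hb hc) => L M.
  by rewrite (mulrDr L) (mulrDl _ _ M) -scalerAr -scalerAl !linearP /=; ring.
- by apply: has_liberation_eq (has_liberation_mul hb hc) => L M; rewrite !mulrA; ring.
Qed.

Lemma generated_has_liberV a : generated_algebra V a -> has_liberation a (fun _ _ => 0).
Proof.
apply: (@generated_algebra_min _ _ _ (fun a => has_liberation a (fun _ _ => 0)));
  last exact: has_liberationV.
split=> [|z b c hb hc|b c hb hc] /=.
- exact: has_liberation1.
- by apply: has_liberation_eq (has_liberation_lin z hb hc) => L M; rewrite mulr0 addr0.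
- by apply: has_liberation_eq (has_liberation_mul hb hc) => L M; rewrite addr0.
Qed.

Lemma has_liberation_word (s : seq (bool * A)) :
  (forall k, (k < size s)%N -> (if (nth (true, 0) s k).1 then generated_algebra U
     else generated_algebra V) (nth (true, 0) s k).2) ->
  has_liberation (aprod s) (liberation phi s).
Proof.
elim: s => [_|[c a] s IH h]; first by rewrite /aprod big_nil; exact: has_liberation1.
rewrite aprod_cons; have hs := IH (fun k ks => h k.+1 ks).
have := h 0%N isT => /=; case: c {h} => [/generated_has_liberU|/generated_has_liberV] ha.
  by apply: has_liberation_eq (has_liberation_mul ha hs) => L M /=; rewrite !mulrA.
by apply: has_liberation_eq (has_liberation_mul ha hs) => L M /=.
Qed.

Lemma free_of_conj_rat : free_elements phi (X + Y)^-1 (X^-1 - (X + Y)^-1).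
Proof.
apply: free_of_liberation => [||s hs]; [exact: state1|exact: state_tracial|].
by have [d g <-] := has_liberation_word hs; exact: liberation_form_rat g.
Qed.
End MatsumotoYorDerivation.

(** * Conjugate variables of a single element *)

Section OneVariable.
Variables (R : realType) (A : cstarAlgType R) (phi : {scalar A}).
Hypothesis Hphi : cstar_probability_space phi.
Variables (X xi : A) (m : R).
Hypothesis Xm : nrm (X - m%:C%:A) < m.
Local Notation dform := (dform A unit).
Implicit Types (a b L M : A) (d e : dform).

Definition dmonom n L M : R[i] :=
  \sum_(j < n) (phi (L * X ^+ j) : R[i]) * phi (X ^+ (n - j.+1) * M).

Definition monom_conj n : Prop := phi (xi * X ^+ n) = dmonom n 1 1.

Let g : A -> dform -> Prop := fun a d => a = X /\ d = dvar phi tt.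

Lemma dmonomS n L M : dmonom n.+1 L M = dmonom n L (X * M) + phi (L * X ^+ n) * phi M.
Proof.
rewrite /dmonom big_ord_recr /= subnn expr0 mul1r; congr (_ + _).
by apply: eq_bigr => j _; rewrite mulrA -exprSr subSn.
Qed.

Lemma dmonom_form n : bilinear_form (fun _ : unit => dmonom n).
Proof.
split=> _ z L L' M; rewrite /dmonom mulr_sumr -big_split; apply: eq_bigr => j _ /=.
  by rewrite mulrDl -scalerAl linearP /=; ring.
by rewrite mulrDr -scalerAr linearP /=; ring.
Qed.

Lemma dmonom_dpow n : (fun _ : unit => dmonom n) = dpow X (dvar phi tt) n.
Proof.
apply/funext => -[]; apply/funext => L; apply/funext => M.
elim: n L M => [|n IH] L M; first by rewrite /dmonom big_ord0.
rewrite /= /dmul /dvar eqxx -IH /dmonom big_ord_recl /= expr0 mulr1 subSS subn0.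
by congr (_ + _); apply: eq_bigr => j _; rewrite /bump /= add1n exprS mulrA subSS.
Qed.

Let gX : dgraph g X (dvar phi tt). Proof. exact: dgraph_gen. Qed.

Let gr x e : g x e -> regular_form e.
Proof. by move=> [_ ->]; exact: dvar_regular. Qed.

Lemma ideal_conj n : (forall k, (n <= k)%N -> monom_conj k) ->
  forall b e, dgraph g b e -> forall k, (n <= k)%N ->
  phi (xi * (X ^+ k * b)) = dmonom k 1 b + e tt (X ^+ k) 1.
Proof.
move=> h b e gb; suff [_] : bilinear_form e /\ forall k, (n <= k)%N ->
  phi (xi * (X ^+ k * b)) = dmonom k 1 b + e tt (X ^+ k) 1 by [].
move: b e gb; apply: dgraph_left_ind.
- by move=> a d [].
- split=> [|k nk]; first exact: bilinear_dzero.
  by rewrite mulr1 addr0; exact: h.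
- move=> z a d b e [db da] [eb ea]; split=> [|k nk]; first exact: bilinear_dlin.
  have [_ mr] := dmonom_form k.
  rewrite mulrDr -scalerAr mulrDr -scalerAr linearP /= da// ea// /dlin (mr tt).
  by ring.
- move=> a d b e [-> ->] [eb ea]; split=> [|k nk].
    by apply: bilinear_dmul => //; exact: bilinear_dvar.
  rewrite (mulrA (X ^+ k)) -exprSr ea ?(leqW nk)// dmonomS /dmul /dvar eqxx !mulr1 -exprSr.
  by rewrite mul1r addrA.
Qed.

(** Dividing by [X]: since [1 / X] is a limit of polynomials in the graph norm,
    the equations for high powers of [X] imply those for low powers. *)
Lemma monom_conj_pred n : (forall k, (n < k)%N -> monom_conj k) -> monom_conj n.
Proof.
move=> h; have m0 : 0 < m by rewrite (le_lt_trans _ Xm)// cstar_norm_ge0.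
pose c : R[i] := m^-1%:C.
have cm : c * m%:C = 1 by rewrite /c -rmorphM /= mulVf ?gt_eqF.
pose T : A := - c *: X + 1; pose dT := dlin (- c) (dvar phi tt) (@dzero R A unit).
have gT : dgraph g T dT by apply: dgraph_lin => //; exact: dgraph1.
have rT := dgraph_regular gr gT.
have T1 : nrm T < 1.
  have -> : T = - c *: (X - m%:C%:A).
    by rewrite scalerBr scalerA !mulNr cm scaleN1r opprK.
  rewrite scaleNr cstar_normN cstar_normZr ?invr_ge0 ?(ltW m0)//.
  by rewrite ltr_pdivrMl// mulr1.
have rn : regular_form (fun _ : unit => dmonom n).
  by rewrite dmonom_dpow; exact: dgraph_regular gr (dgraph_pow n gX).
have XT b : b - T * b = c *: (X * b).
  by rewrite /T mulrDl mul1r opprD addrCA subrr addr0 -scalerAl scaleNr opprK.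
have TX b : b - b * T = c *: (b * X).
  by rewrite /T mulrDr mulr1 opprD addrCA subrr addr0 -scalerAr scaleNr opprK.
pose G : A -> dform -> Prop := conj_eq phi (fun=> xi).
have cG : gclosure G (X ^+ n) (fun _ : unit => dmonom n).
  apply: (gclosure_pow rn rT T1) => N [].
  elim: N => [|N IH].
    by rewrite /dmul /= /dzero expr0 mulr1 subrr mulr0 linear0 mul1r addr0 subrr.
  have -> : X ^+ n - X ^+ n * T ^+ N.+1 = (X ^+ n - X ^+ n * T ^+ N) + c *: (X ^+ n.+1 * T ^+ N).
    by rewrite (exprS T) (exprSr X) -(mulrA (X ^+ n) X) scalerAr -XT mulrBr addrA subrK.
  rewrite mulrDr linearD /= IH -scalerAr linearZ /=.
  have gN := dgraph_pow N gT; have bN := (dgraph_regular gr gN).1.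
  rewrite (ideal_conj h gN)// dmonomS.
  rewrite /dmul /= /dmul !mulr1 !mul1r (exprS T) /dT /dlin /dvar /dzero eqxx.
  have -> : T * T ^+ N = T ^+ N - c *: (X * T ^+ N) by rewrite -XT subKr.
  have -> : X ^+ n * T = X ^+ n - c *: (X ^+ n * X) by rewrite -TX subKr.
  have mb := dmonom_form n.
  have := formBr tt 1 (T ^+ N) (c *: (X * T ^+ N)) mb => /= ->.
  have := formZr tt c 1 (X * T ^+ N) mb => /= ->.
  rewrite formBl// formZl// -exprSr; ring.
exact: (conj_eq_closure Hphi _ cG) tt.
Qed.

Lemma monom_conj_all n : (forall k, (n <= k)%N -> monom_conj k) -> forall k, monom_conj k.
Proof.
elim: n => [h k|n IH h]; first exact: h.
by apply: IH => k; rewrite leq_eqVlt => /predU1P[<-|/h//]; exact: monom_conj_pred.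
Qed.
End OneVariable.

Section MomentSequences.
Variables (R : comNzRingType) (m al be v : R) (s mo : nat -> R).
Hypothesis s0 : s 0%N = v.
Hypothesis s_rec : forall n, s n.+1 - m * s n = \sum_(j < n) s j * s (n - j.+1)%N.
Hypothesis mo0 : mo 0%N = 1.
Hypothesis moSS : forall i, mo i.+2 = al * s i.+1 + be * s i.

(** The Schwinger-Dyson equations of the density
    [(al / t + be / t^2) sigma(dt)] in terms of those of the semicircle
    distribution [sigma] of mean [m] and mass [v].  Moments of order at least [2]
    are polynomial moments of [sigma]; in degree at least [4] the order [0] and
    [1] moments occur only in the extreme terms of the sum. *)
Lemma moment_rec k :
  al * mo k.+4 + (be - m * al + 2) * mo k.+3 - (m * be + 2 * al * v - 2 * mo 1%N) * mo k.+2 =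
  \sum_(j < k.+4) mo j * mo (k.+4 - j.+1)%N.
Proof.
have c2 : s k.+3 - m * s k.+2 = v * s k.+1 + \sum_(i < k) s i.+1 * s (k - i)%N + s k.+1 * v.
  rewrite s_rec big_ord_recl big_ord_recr /= subSS subn0 /bump /= add1n subnn s0 addrA.
  by congr (_ + _ + _); apply: eq_bigr => i _; rewrite add1n.
have c1 : s k.+2 - m * s k.+1 = v * s k + \sum_(i < k) s i.+1 * s (k - i.+1)%N.
  by rewrite s_rec big_ord_recl /= subSS subn0 s0.
have c1' : s k.+2 - m * s k.+1 = \sum_(i < k) s i * s (k - i)%N + s k * v.
  by rewrite s_rec big_ord_recr /= subnn s0.
have c0 := s_rec k.
rewrite big_ord_recl big_ord_recl big_ord_recr big_ord_recr /=.
rewrite /bump /= !add1n mo0.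
have -> : \sum_(i < k) mo (1 + (1 + i))%N * mo (k.+4 - (1 + (1 + i)).+1)%N =
  al ^+ 2 * (\sum_(i < k) s i.+1 * s (k - i)%N)
  + al * be * (\sum_(i < k) s i.+1 * s (k - i.+1)%N)
  + al * be * (\sum_(i < k) s i * s (k - i)%N)
  + be ^+ 2 * (\sum_(i < k) s i * s (k - i.+1)%N).
  rewrite !mulr_sumr -!big_split; apply: eq_bigr => i _ /=.
  rewrite !add1n moSS.
  have -> : (k.+4 - i.+3)%N = (k - i.+1).+2 by have := ltn_ord i; lia.
  rewrite moSS; have -> : (k - i.+1).+1 = (k - i)%N by have := ltn_ord i; lia.
  by ring.
rewrite -c0.
have -> : \sum_(i < k) s i.+1 * s (k - i)%N = s k.+3 - m * s k.+2 - v * s k.+1 - s k.+1 * v.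
  by rewrite c2; ring.
have -> : \sum_(i < k) s i.+1 * s (k - i.+1)%N = s k.+2 - m * s k.+1 - v * s k.
  by rewrite c1; ring.
have -> : \sum_(i < k) s i * s (k - i)%N = s k.+2 - m * s k.+1 - s k * v.
  by rewrite c1'; ring.
rewrite !subSS !subn0 subnn mo0 !moSS.
by rewrite subSnn; ring.
Qed.
End MomentSequences.

(** * Semicircle and weighted semicircle distributions *)

Section Chebyshev.
Variables (R : comNzRingType) (m v : R).
Implicit Types (p q : {poly R}).

(** Consecutive pairs, so that the two-step recursion is structural. *)
Fixpoint cheb2 n : {poly R} * {poly R} :=
  if n is k.+1 then
    let: (p, q) := cheb2 k in (('X - m%:P) * p - v *: q, p)
  else (1, 0).

(** Monic Chebyshev polynomials of the second kind, orthogonal for the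
    semicircle of mean [m] and variance [v]. *)
Definition cheb n := (cheb2 n).1.

Lemma cheb0 : cheb 0 = 1. Proof. by []. Qed.

Lemma cheb1 : cheb 1 = 'X - m%:P.
Proof. by rewrite /cheb /= mulr1 scaler0 subr0. Qed.

Lemma chebSS n : cheb n.+2 = ('X - m%:P) * cheb n.+1 - v *: cheb n.
Proof. by rewrite /cheb /=; case: (cheb2 n) => p q. Qed.

Variable psi : {poly R} -> R.
Hypothesis psi_lin : forall z p q, psi (z *: p + q) = z * psi p + psi q.
Hypothesis psi_cheb : forall n, psi (cheb n) = if n is 0%N then v else 0.

Let psiD p q : psi (p + q) = psi p + psi q.
Proof. by have := psi_lin 1 p q; rewrite scale1r mul1r. Qed.
Let psi0 : psi 0 = 0.
Proof. by have := psi_lin (-1) 0 0; rewrite scaler0 addr0 mulN1r addNr. Qed.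
Let psiZ z p : psi (z *: p) = z * psi p.
Proof. by have := psi_lin z p 0; rewrite addr0 psi0 addr0. Qed.

(** [q] is the partial evaluation by [psi] of the difference quotient of [p]; on
    [cheb n.+1] orthogonality leaves a single term. *)
Inductive cheb_pair : {poly R} -> {poly R} -> Prop :=
| cheb_pair0 : cheb_pair 1 0
| cheb_pairS n : cheb_pair (cheb n.+1) (v *: cheb n)
| cheb_pair_lin z p q p' q' : cheb_pair p q -> cheb_pair p' q' ->
    cheb_pair (z *: p + p') (z *: q + q').

Lemma cheb_pair_psi p q : cheb_pair p q -> psi (('X - m%:P) * p) = psi q.
Proof.
elim=> {p q} [|n|z p q p' q' _ IH _ IH'].
- by rewrite mulr1 psi0 -cheb1 psi_cheb.
- have -> : ('X - m%:P) * cheb n.+1 = v *: cheb n + cheb n.+2.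
    by rewrite chebSS [RHS]addrC subrK.
  by rewrite psi_lin !psi_cheb addr0 psiZ psi_cheb.
- by rewrite mulrDr -scalerAr !psi_lin IH IH'.
Qed.

(** Leibniz rule for a product with the variable. *)
Lemma cheb_pairX p q : cheb_pair p q -> cheb_pair ('X * p) ('X * q + (psi p)%:P).
Proof.
elim=> {p q} [|n|z p q p' q' h IH h' IH'].
- rewrite mulr1 mulr0 add0r -cheb0 psi_cheb.
  have -> : 'X = m *: 1 + cheb 1 by rewrite cheb1 alg_polyC [RHS]addrC subrK.
  have -> : v%:P = m *: 0 + v *: cheb 0 by rewrite scaler0 add0r cheb0 alg_polyC.
  by apply: cheb_pair_lin; [exact: cheb_pair0|exact: cheb_pairS].
- have eX k : 'X * cheb k.+1 = m *: cheb k.+1 + (v *: cheb k + cheb k.+2).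
    by rewrite chebSS [v *: _ + _]addrC subrK mulrBl mul_polyC [RHS]addrC subrK.
  rewrite psi_cheb addr0 eX; case: n => [|n].
    have -> : 'X * (v *: cheb 0) = m *: (v *: cheb 0) + (v *: 0 + v *: cheb 1).
      rewrite scaler0 add0r cheb1 cheb0 -scalerAr mulr1 scalerA mulrC -scalerA -scalerDr.
      by rewrite alg_polyC [m%:P + _]addrC subrK.
    apply: cheb_pair_lin; first exact: cheb_pairS.
    by apply: cheb_pair_lin; [exact: cheb_pair0|exact: cheb_pairS].
  have -> : 'X * (v *: cheb n.+1) = m *: (v *: cheb n.+1) + (v *: (v *: cheb n) + v *: cheb n.+2).
    by rewrite -scalerAr eX scalerDr scalerDr !scalerA [v * m]mulrC.
  apply: cheb_pair_lin; first exact: cheb_pairS.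
  by apply: cheb_pair_lin; exact: cheb_pairS.
- rewrite mulrDr -scalerAr psi_lin.
  have -> : 'X * (z *: q + q') + (z * psi p + psi p')%:P =
     z *: ('X * q + (psi p)%:P) + ('X * q' + (psi p')%:P).
    by rewrite mulrDr -scalerAr polyCD polyCM mul_polyC scalerDr addrACA.
  exact: cheb_pair_lin.
Qed.

(** Schwinger-Dyson equations of the semicircle: the Chebyshev polynomials have
    the difference quotients [sum_k cheb k (x) cheb (n - 1 - k)], so
    orthogonality is enough. *)
Lemma semicircle_rec n : psi 'X^(n.+1) - m * psi 'X^n =
  \sum_(j < n) psi 'X^j * psi 'X^(n - j.+1).
Proof.
have h k : cheb_pair 'X^k (\sum_(j < k) psi 'X^j *: 'X^(k - j.+1)).
  elim: k => [|k IH]; first by rewrite big_ord0 expr0; exact: cheb_pair0.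
  have := cheb_pairX IH; rewrite -exprS big_ord_recr /= subnn expr0 alg_polyC.
  rewrite mulr_sumr; congr (cheb_pair _ (_ + _)).
  by apply: eq_bigr => j _; rewrite -scalerAr -exprS subSn.
have := cheb_pair_psi (h n); rewrite mulrBl mul_polyC -exprS.
rewrite -scaleNr addrC psi_lin => e; rewrite addrC -mulNr e.
elim: n {h e} => [|n IH] //=.
  by rewrite !big_ord0.
have gen k (F : 'I_k -> R) (G : 'I_k -> {poly R}) :
    psi (\sum_(j < k) F j *: G j) = \sum_(j < k) F j * psi (G j).
  elim: k F G => [|k IHk] F G; first by rewrite !big_ord0.
  by rewrite !big_ord_recr /= psiD psiZ IHk.
exact: gen.
Qed.
End Chebyshev.

Section SemicircleIntegral.
Variable R : realType.
Local Notation leb := (@lebesgue_measure R).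
Implicit Types (x t c : R).

Lemma sin_natpi n : sin (n%:R * pi) = 0 :> R.
Proof.
elim: n => [|n IH]; first by rewrite mul0r sin0.
by rewrite -natr1 mulrDl mul1r sinDpi IH oppr0.
Qed.

Lemma is_derive_sinM c x : is_derive x 1 (fun t => sin (c * t)) (cos (c * x) * c).
Proof.
have h : is_derive x 1 (fun t => c * t) c.
  by apply: is_derive_eq; rewrite /GRing.scale /= mulr1.
have := @is_derive1_comp R sin (fun t => c * t) x _ _ (is_derive_sin _) h.
by [].
Qed.

Lemma is_derive_sinMV c x : c != 0 ->
  is_derive x 1 (fun t => sin (c * t) / c / 2) (cos (c * x) / 2).
Proof.
move=> c0; have ds := is_derive_sinM c x.
by apply: is_derive_eq; rewrite /GRing.scale /=; field.
Qed.

Lemma sin_mul_sin (n : nat) x :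
  sin (n.+1%:R * x) * sin x = (cos (n%:R * x) - cos (n.+2%:R * x)) / 2.
Proof.
have -> : n.+2%:R * x = n.+1%:R * x + x by rewrite -natr1; ring.
have -> : n%:R * x = n.+1%:R * x - x by rewrite -natr1; ring.
by rewrite cosB cosD; field.
Qed.

Lemma integral_sin_mul_sin (n : nat) :
  (\int[leb]_(t in `[0%R, pi]) (sin (n.+1%:R * t) * sin t)%:E =
   (if n is 0%N then pi / 2 else 0)%:E)%E.
Proof.
pose H : R -> R := fun t =>
  (if n is k.+1 then sin (n%:R * t) / n%:R else t) / 2 - sin (n.+2%:R * t) / n.+2%:R / 2.
have dH x : is_derive x 1 H (sin (n.+1%:R * x) * sin x).
  rewrite sin_mul_sin mulrBl.
  have d2 : is_derive x 1 (fun t => sin (n.+2%:R * t) / n.+2%:R / 2) (cos (n.+2%:R * x) / 2).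
    by apply: is_derive_sinMV; rewrite pnatr_eq0.
  have d1 : is_derive x 1 (fun t => (if n is k.+1 then sin (n%:R * t) / n%:R else t) / 2)
      (cos (n%:R * x) / 2).
    case: n {H d2} => [|k].
      by apply: is_derive_eq; rewrite /GRing.scale /= mul0r cos0; ring.
    by apply: is_derive_sinMV; rewrite pnatr_eq0.
  exact: is_deriveB.
have cH x : {for x, continuous H}.
  by apply: differentiable_continuous; apply/derivable1_diffP; case: (dH x).
have cs x : {for x, continuous (fun t : R => sin (n.+1%:R * t))}.
  apply: differentiable_continuous; apply/derivable1_diffP.
  by case: (is_derive_sinM n.+1%:R x).
rewrite (@continuous_FTC2 _ _ H) ?pi_gt0//.
- rewrite /H -EFinB; congr _%:E.
  rewrite !mulr0 sin0 !sin_natpi !mul0r !subr0.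
  by case: n {H dH cH cs} => [|k]; rewrite ?sin_natpi ?mulr0 ?sin0 !mul0r subr0.
- apply: continuous_subspaceT => x; apply: cvgM; first exact: cs.
  exact: continuous_sin.
- split=> [x _||]; first by case: (dH x).
    exact: cvg_at_right_filter (cH 0).
  exact: cvg_at_left_filter (cH pi).
- by move=> x _; rewrite derive1E; case: (dH x).
Qed.

Variables (a b : R).
Hypothesis ab : a < b.
Let m := (a + b) / 2.
Let r := (b - a) / 2.
Let v := ((b - a) / 4) ^+ 2.
Implicit Type p : {poly R}.

Definition semicircle_density t : R := (2 * pi)^-1 * Num.sqrt ((t - a) * (b - t)).

Lemma cheb_cos n x : (cheb m v n).[m + r * cos x] * sin x = (r / 2) ^+ n * sin (n.+1%:R * x).
Proof.
have v_r : v = (r / 2) ^+ 2 by rewrite /v /r; field.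
suff [] : (cheb m v n).[m + r * cos x] * sin x = (r / 2) ^+ n * sin (n.+1%:R * x) /\
  (cheb m v n.+1).[m + r * cos x] * sin x = (r / 2) ^+ n.+1 * sin (n.+2%:R * x) by [].
elim: n => [|n [IH1 IH2]]; split => //.
- by rewrite cheb0 hornerE expr0 !mul1r.
- have -> : 2%:R * x = x + x by ring.
  by rewrite cheb1 !hornerE expr1 sinD; field.
- rewrite chebSS !hornerE mulrBl -mulrA IH2 -(mulrA v) IH1 v_r.
  have -> : n.+3%:R * x = n.+2%:R * x + x by rewrite -natr1; ring.
  have -> : n.+1%:R * x = n.+2%:R * x - x by rewrite -[n.+2%:R]natr1; ring.
  by rewrite (sinD (n.+2%:R * x) x) (sinB (n.+2%:R * x) x) !exprS; field.
Qed.

Lemma continuous_semicircle_density : continuous semicircle_density.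
Proof.
move=> t; apply: cvgM; first exact: cvg_cst.
apply: continuous_comp; last exact: sqrt_continuous.
apply: cvgM; first by apply: cvgB => //; exact: cvg_cst.
by apply: cvgB => //; exact: cvg_cst.
Qed.

Lemma continuous_semicircle p :
  continuous (fun t => p.[t] * semicircle_density t).
Proof.
by move=> t; apply: cvgM; [exact: continuous_horner|exact: continuous_semicircle_density].
Qed.

Lemma integrable_semicircle p :
  leb.-integrable `[a, b] (EFin \o (fun t => p.[t] * semicircle_density t)).
Proof.
apply: continuous_compact_integrable; first exact: segment_compact.
by apply: continuous_subspaceT; exact: continuous_semicircle.
Qed.

(** Substitute [t = m + r cos x], which turns the square root into [r sin x]. *)
Lemma integral_semicircle_cos p :
  (\int[leb]_(t in `[a, b]) (p.[t] * semicircle_density t)%:E =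
   \int[leb]_(x in `[0%R, pi]) (p.[m + r * cos x] * sin x * sin x * (r ^+ 2 / (2 * pi)))%:E)%E.
Proof.
have r0 : 0 < r by rewrite /r divr_gt0 ?subr_gt0.
pose F x : R := m + r * cos x.
have dF x : is_derive x 1 F (- (r * sin x)).
  apply: is_derive_eq; rewrite /GRing.scale /=; ring.
have F0 : F 0 = b by rewrite /F cos0 /m /r; field.
have Fpi : F pi = a by rewrite /F cospi /m /r; field.
have F1 : derive1 F = (fun x => - (r * sin x)).
  by apply/funext => x; rewrite derive1E; case: (dF x).
have cF1 : continuous (derive1 F).
  rewrite F1 => x; apply: cvgN; apply: cvgM; first exact: cvg_cst.
  exact: continuous_sin.
have cF x : {for x, continuous F}.
  by apply: differentiable_continuous; apply/derivable1_diffP; case: (dF x).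
rewrite -[in LHS]F0 -[in LHS]Fpi (@integration_by_substitution_decreasing _ F); last 7 first.
- exact: pi_ge0.
- move=> x y x0 y0 xy; rewrite /F ltrD2l ltr_pM2l//.
  by rewrite ltr_cos.
- by move=> x _; exact: cF1.
- by apply: cvgP; apply: cvg_at_right_filter; exact: cF1.
- by apply: cvgP; apply: cvg_at_left_filter; exact: cF1.
- split=> [x _||]; first by case: (dF x).
    exact: cvg_at_right_filter (cF 0).
  exact: cvg_at_left_filter (cF pi).
- by apply: continuous_subspaceT; exact: continuous_semicircle.
apply: eq_integral => x; rewrite inE /= in_itv /= => x0pi; congr _%:E.
rewrite !fctE F1 /semicircle_density opprK -/(F x).
have s0 := sin_ge0_pi x0pi.
have -> : (F x - a) * (b - F x) = (r * sin x) ^+ 2.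
  by rewrite exprMn sin2cos2 /F /m /r; field.
have rs : 0 <= r * sin x by apply: mulr_ge0; rewrite ?(ltW r0).
rewrite sqrtr_sqr ger0_norm//.
by move: (2 * pi)^-1 p.[F x] (sin x) => c d e; ring.
Qed.

Definition semicircle_mean p : R :=
  \int[leb]_(t in `[a, b]) (p.[t] * semicircle_density t).

Lemma semicircle_mean_lin z p q :
  semicircle_mean (z *: p + q) = z * semicircle_mean p + semicircle_mean q.
Proof.
rewrite /semicircle_mean -RintegralZl//; last exact: integrable_semicircle.
rewrite -RintegralD//.
- by apply: eq_Rintegral => t _; rewrite hornerD hornerZ; ring.
- have := integrable_semicircle (z *: p); congr (integrable _ _ _).
  by apply/funext => t /=; rewrite hornerZ -mulrA.
- exact: integrable_semicircle.
Qed.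

Lemma semicircle_mean_cheb n :
  semicircle_mean (cheb m v n) = if n is 0%N then v else 0.
Proof.
rewrite /semicircle_mean /Rintegral integral_semicircle_cos.
have -> : (\int[leb]_(x in `[0%R, pi])
    ((cheb m v n).[m + r * cos x] * sin x * sin x * (r ^+ 2 / (2 * pi)))%:E =
   \int[leb]_(x in `[0%R, pi])
    (((r / 2) ^+ n * (r ^+ 2 / (2 * pi)))%:E * (sin (n.+1%:R * x) * sin x)%:E))%E.
  by apply: eq_integral => x _; rewrite cheb_cos -EFinM; congr _%:E; ring.
rewrite integralZl//; last first.
  apply: continuous_compact_integrable; first exact: segment_compact.
  apply: continuous_subspaceT => x; apply: cvgM; last exact: continuous_sin.
  apply: differentiable_continuous; apply/derivable1_diffP.
  by case: (is_derive_sinM n.+1%:R x).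
rewrite integral_sin_mul_sin; case: n => [|n]; rewrite -EFinM /= ?mulr0//.
have : pi != 0 :> R by rewrite gt_eqF ?pi_gt0.
by move: (pi : R) => q q0; rewrite /v /r; field.
Qed.

Lemma semicircle_moments n :
  semicircle_mean 'X^(n.+1) - m * semicircle_mean 'X^n =
  \sum_(j < n) semicircle_mean 'X^j * semicircle_mean 'X^(n - j.+1).
Proof. exact: (semicircle_rec semicircle_mean_lin semicircle_mean_cheb). Qed.

Lemma semicircle_mass : semicircle_mean 'X^0 = v.
Proof. by rewrite expr0 -(cheb0 m v) semicircle_mean_cheb. Qed.
End SemicircleIntegral.

Section Density.
Variable R : realType.
Local Notation leb := (@lebesgue_measure R).
Variable mu : probability (measurableTypeR R) R.
Variables (D : set R) (rho : R -> R).
Hypotheses (mD : measurable D) (rho_meas : measurable_fun D rho).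
Hypothesis muE : forall E : set R, measurable E ->
  mu E = (\int[leb]_(x in E `&` D) (rho x)%:E)%E.

Lemma density_dominated : mu `<< leb.
Proof.
apply/null_content_dominatesP => E mE E0; rewrite muE//.
apply: null_set_integral; first exact: measurableI.
  by apply/measurable_EFinP; apply: measurable_funS rho_meas => //; exact: subIsetr.
by apply/eqP; rewrite eq_le measure_ge0 andbT -[leRHS]E0 measureIl.
Qed.

Lemma density_setC : mu (~` D) = 0%E.
Proof. by rewrite muE; [rewrite setICl integral_set0|exact: measurableC]. Qed.

(** The density is almost everywhere the Radon-Nikodym derivative. *)
Lemma integral_density (f : R -> R) : measurable_fun setT f -> [bounded f x | x in D] ->
  (\int[mu]_x (f x)%:E = \int[leb]_(x in D) (f x * rho x)%:E)%E.
Proof.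
move=> mf bf.
have mfD : measurable_fun D f by exact: measurable_funTS.
have If : mu.-integrable D (EFin \o f).
  apply: measurable_bounded_integrable => //.
  by rewrite (le_lt_trans (probability_le1 mu _))// ltry.
transitivity (\int[mu]_(x in D) (f x)%:E)%E.
  rewrite [RHS]integral_mkcond; apply: ae_eq_integral => //.
  - exact/measurable_EFinP.
  - by apply/(measurable_restrictT _ mD); exact/measurable_EFinP.
  exists (~` D); split; [exact: measurableC|exact: density_setC|].
  move=> x /= h Dx; apply: h => _; rewrite patchE mem_set//.
rewrite -(Radon_Nikodym_change_of_variables density_dominated mD If).
apply: ae_eq_integral => //.
- apply: emeasurable_funM; first exact/measurable_EFinP.
  apply: measurable_funTS; apply: (measurable_int leb).
  by apply: Radon_Nikodym_integrable; exact: density_dominated.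
- by apply/measurable_EFinP; exact: measurable_funM.
have -> : (fun x => (f x * rho x)%:E) = ((EFin \o f) \* (EFin \o rho))%E by [].
apply: ae_eqe_mul2l => /=.
apply: integral_ae_eq => //.
- apply: (integrableS _ _ (@subsetT _ _)) => //=.
  by apply: Radon_Nikodym_integrable; exact: density_dominated.
- exact/measurable_EFinP.
move=> E ED mE; rewrite -Radon_Nikodym_integral//; last exact: density_dominated.
transitivity (mu E); first by [].
by rewrite muE// (setIidl ED).
Qed.
End Density.

Section WeightedSemicircle.
Variable R : realType.
Local Notation leb := (@lebesgue_measure R).
Variable mu : probability (measurableTypeR R) R.
Variables (a b al be : R) (b0 b1 : bool).
Hypotheses (a_gt0 : 0 < a) (ab : a < b) (al_ge0 : 0 <= al) (be_ge0 : 0 <= be).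
Let D := [set` Interval (BSide b0 a) (BSide b1 b)].
Let w (x : R) : R := (al / x + be / x ^+ 2) * semicircle_density a b x.
Hypothesis muE : forall E : set R, measurable E ->
  mu E = (\int[leb]_(x in E `&` D) (w x)%:E)%E.
Let m := (a + b) / 2.
Let r := (b - a) / 2.
Implicit Types (p q : {poly R}) (n : nat).

Let Dab x : D x -> a <= x <= b.
Proof.
rewrite /D /=; case: b0; case: b1; rewrite in_itv /= => /andP[h1 h2];
  by apply/andP; split; do [assumption | exact: ltW].
Qed.

Let Dsub : D `<=` `[a, b]%classic.
Proof. by move=> x /Dab; rewrite /= in_itv. Qed.

Let w_cont : {within `[a, b], continuous w}.
Proof.
apply: continuous_in_subspaceT => x; rewrite inE /= in_itv /= => /andP[ax _].
have x0 : x != 0 by rewrite gt_eqF// (lt_le_trans a_gt0).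
apply: cvgM; last exact: continuous_semicircle_density.
apply: cvgD; apply: cvgM; try exact: cvg_cst; apply: cvgV => //.
  by rewrite expf_neq0.
exact: exprn_continuous.
Qed.

Let w_ge0 x : a <= x -> 0 <= w x.
Proof.
move=> ax; have x0 := lt_le_trans a_gt0 ax.
rewrite /w /semicircle_density mulr_ge0//.
  by rewrite addr_ge0// divr_ge0// ?exprn_ge0// ltW.
by rewrite mulr_ge0// invr_ge0 mulr_ge0// pi_ge0.
Qed.

Let w_meas : measurable_fun D w.
Proof.
apply: (@measurable_funS _ _ _ _ `[a, b]%classic) => //.
exact: subspace_continuous_measurable_fun.
Qed.

Definition poly_mean p : R := \int[mu]_x p.[x].

Lemma poly_meanE p : poly_mean p = \int[leb]_(x in `[a, b]) (p.[x] * w x).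
Proof.
have cp : {within `[a, b], continuous (fun x => p.[x])}.
  by apply: continuous_subspaceT; exact: continuous_horner.
rewrite /poly_mean /Rintegral (integral_density _ w_meas muE)//.
- congr fine; rewrite /D integral_itv_bndoo; last first.
    apply/measurable_EFinP; apply: (@measurable_funS _ _ _ _ `[a, b]%classic) => //.
      exact: subset_itv_oo_cc.
    apply: subspace_continuous_measurable_fun => // x.
    by apply: cvgM; [exact: cp|exact: w_cont].
  rewrite [RHS]integral_itv_bndoo//.
  apply/measurable_EFinP; apply: (@measurable_funS _ _ _ _ `[a, b]%classic) => //.
    exact: subset_itv_oo_cc.
  apply: subspace_continuous_measurable_fun => // x.
  by apply: cvgM; [exact: cp|exact: w_cont].
- exact: measurable_itv.
- by apply: continuous_measurable_fun; exact: continuous_horner.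
- have cK : compact (horner p @` `[a, b]%classic).
    by apply: continuous_compact => //; exact: segment_compact.
  have [M [Mr hM]] := compact_bounded cK.
  exists M; split=> // x Mx t Dt; apply: (hM x Mx); exists t => //; exact: Dsub.
Qed.

Let w_int p : leb.-integrable `[a, b] (EFin \o (fun x => p.[x] * w x)).
Proof.
apply: continuous_compact_integrable; first exact: segment_compact.
move=> x; apply: cvgM; last exact: w_cont.
by apply: continuous_subspaceT; exact: continuous_horner.
Qed.

Lemma poly_mean_lin z p q : poly_mean (z *: p + q) = z * poly_mean p + poly_mean q.
Proof.
rewrite !poly_meanE -RintegralZl// -RintegralD//.
- by apply: eq_Rintegral => t _; rewrite hornerD hornerZ; ring.
- have := w_int (z *: p); congr (integrable _ _ _).
  by apply/funext => t /=; rewrite hornerZ -mulrA.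
Qed.

Lemma poly_mean1 : poly_mean 1 = 1.
Proof.
rewrite /poly_mean /Rintegral (eq_integral (cst 1%E)); last by move=> x _; rewrite hornerE.
by rewrite integral_cst// mul1e /= probability_setT.
Qed.

(** The measure lives in the ball of radius [r] around [m]. *)
Lemma poly_mean_le_pow n : poly_mean (('X - m%:P) ^+ (2 * n)) <= r ^+ (2 * n).
Proof.
have -> : r ^+ (2 * n) = poly_mean (r ^+ (2 * n))%:P.
  have := poly_mean_lin (r ^+ (2 * n)) 1 0; rewrite addr0 poly_mean1 alg_polyC => ->.
  have := poly_mean_lin (-1) 0 0; rewrite scaler0 addr0 mulN1r addNr => ->.
  by rewrite mulr1 addr0.
rewrite !poly_meanE; apply: le_Rintegral => // x; rewrite /= in_itv /= => /andP[ax xb].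
apply: ler_wpM2r; first exact: w_ge0.
rewrite !hornerE !exprM lerXn2r ?nnegrE ?sqr_ge0//.
rewrite -[leLHS]real_normK ?num_real// lerXn2r ?nnegrE//.
  by rewrite /r divr_ge0// subr_ge0 ltW.
by rewrite ler_norml /m /r; apply/andP; split; lra.
Qed.

Lemma poly_mean_moment n : poly_mean 'X^(n.+2) =
  al * semicircle_mean a b 'X^(n.+1) + be * semicircle_mean a b 'X^n.
Proof.
rewrite poly_meanE /semicircle_mean -!RintegralZl//; try exact: integrable_semicircle.
rewrite -RintegralD//.
- apply: eq_Rintegral => x; rewrite inE /= in_itv /= => /andP[ax _].
  have x0 : x != 0 by rewrite gt_eqF// (lt_le_trans a_gt0).
  rewrite /w !hornerXn; move: (semicircle_density a b x) => s.
  by rewrite (exprS x n.+1) (exprS x n); move: (x ^+ n) => y; field.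
- have := integrable_semicircle a b (al *: 'X^(n.+1)); congr (integrable _ _ _).
  by apply/funext => t /=; rewrite hornerZ -mulrA.
- have := integrable_semicircle a b (be *: 'X^n); congr (integrable _ _ _).
  by apply/funext => t /=; rewrite hornerZ -mulrA.
Qed.

Lemma poly_mean_moment1 : be = 0 -> poly_mean 'X^1 = al * semicircle_mean a b 'X^0.
Proof.
move=> be0; rewrite poly_meanE /semicircle_mean -RintegralZl//; last exact: integrable_semicircle.
apply: eq_Rintegral => x; rewrite inE /= in_itv /= => /andP[ax _].
have x0 : x != 0 by rewrite gt_eqF// (lt_le_trans a_gt0).
rewrite /w be0 !hornerXn; move: (semicircle_density a b x) => s.
by rewrite expr0 expr1; field.
Qed.
End WeightedSemicircle.

Section InverseClosure.
Variables (R : realType) (A : cstarAlgType R) (phi : {scalar A}).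
Hypothesis Hphi : cstar_probability_space phi.

Lemma inv_in_closure (X : A) (m : R) (c1 c2 c3 : R[i]) : nrm (X - m%:C%:A) < m ->
  forall eps : R, 0 < eps -> exists2 q, generated_algebra X q &
    nrm (c1 *: 1 + c2 *: X^-1 - c3 *: X^-1 ^+ 2 - q) <= eps.
Proof.
move=> Xm eps e0; pose x := fun _ : unit => X.
pose g := single_gen phi x tt.
pose h : A -> dform A unit -> Prop := fun a d => a = X^-1 /\ d = dinv X (dvar phi tt).
have gr a d : g a d -> regular_form d by move=> [_ ->]; exact: dvar_regular.
have hg a d : h a d -> gclosure (dgraph g) a d.
  by move=> [-> ->]; apply: (gclosure_inv gr _ Xm); exact: dgraph_gen.
have hX : dgraph h X^-1 (dinv X (dvar phi tt)) by exact: dgraph_gen.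
have [d hd] : exists d, dgraph h (c1 *: 1 + c2 *: X^-1 - c3 *: X^-1 ^+ 2) d.
  eexists; rewrite addrC -scaleNr expr2; apply: dgraph_lin.
    by apply: dgraph_mul; exact: hX.
  apply: dgraph_lin; first exact: dgraph1.
  rewrite -[c2 *: _]addr0; apply: dgraph_lin; first exact: hX.
  have -> : 0 = (-1 : R[i]) *: (1 : A) + 1 by rewrite scaleN1r addNr.
  by apply: dgraph_lin; exact: dgraph1.
have [_ /(_ _ e0)[q [e [gq qe _]]]] := gclosure_dgraph gr hg hd.
by exists q => //; exact: single_gen_alg gq.
Qed.
End InverseClosure.

Section WeightedSemicircleElement.
Variables (R : realType) (A : cstarAlgType R) (phi : {scalar A}).
Hypothesis Hphi : cstar_probability_space phi.
Variable mu : probability (measurableTypeR R) R.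
Variables (a b al be : R) (b0 b1 : bool).
Hypotheses (a_gt0 : 0 < a) (ab : a < b) (al_ge0 : 0 <= al) (be_ge0 : 0 <= be).
Hypothesis muE : forall E : set R, measurable E ->
  mu E = (\int[@lebesgue_measure R]_(x in E `&` [set` Interval (BSide b0 a) (BSide b1 b)])
    ((al / x + be / x ^+ 2) * semicircle_density a b x)%:E)%E.
Variable X : A.
Hypothesis HX : has_distribution phi X mu.
Let m := (a + b) / 2.
Let r := (b - a) / 2.
Let v := ((b - a) / 4) ^+ 2.
Let mo n := poly_mean mu 'X^n.

Lemma moment_poly_mean n : phi (X ^+ n) = (mo n)%:C.
Proof.
have [_ _ ->] := HX; congr (_%:C); apply: eq_Rintegral => t _.
by rewrite hornerXn.
Qed.

Lemma shifted_moment k n : phi ((X - m%:C%:A) ^+ k * X ^+ n) =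
  (poly_mean mu (('X - m%:P) ^+ k * 'X^n))%:C.
Proof.
elim: k n => [|k IH] n; first by rewrite !expr0 !mul1r moment_poly_mean.
have -> : (X - m%:C%:A) ^+ k.+1 * X ^+ n =
    (- m%:C) *: ((X - m%:C%:A) ^+ k * X ^+ n) + (X - m%:C%:A) ^+ k * X ^+ n.+1.
  rewrite exprSr -mulrA mulrBl -exprS -scalerAl mul1r mulrBr -scalerAr.
  by rewrite addrC scaleNr.
have -> : ('X - m%:P) ^+ k.+1 * 'X^n =
    (- m) *: (('X - m%:P) ^+ k * 'X^n) + ('X - m%:P) ^+ k * 'X^(n.+1).
  by rewrite exprSr exprS -mul_polyC polyCN; ring.
rewrite linearP /= !IH (poly_mean_lin a_gt0 muE).
by rewrite -[- m%:C](rmorphN (real_complex R) m) -rmorphM -rmorphD.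
Qed.

Lemma norm_sub_mean : nrm (X - m%:C%:A) < m.
Proof.
have [sX _ _] := HX.
have r0 : 0 <= r by rewrite /r divr_ge0// subr_ge0 ltW.
have rm : r < m by rewrite /r /m; have := a_gt0; lra.
apply: (@le_lt_trans _ _ ((r + m) / 2)); last by lra.
apply: (norm_le_of_moments Hphi) (r0) _ _; first by rewrite starB starZr star1 sX.
  by lra.
move=> n; have := shifted_moment (2 * n) 0; rewrite !expr0 !mulr1 => ->.
by rewrite lecR; exact: (poly_mean_le_pow a_gt0 ab al_ge0 be_ge0 muE).
Qed.

Let ka := be - m * al + 2.
Let bt := m * be + 2 * al * v - 2 * mo 1.
(** Up to the value of [bt] this is the derivative of the potential of the
    distribution, evaluated at [X]. *)
Let xi : A := al%:C *: 1 + ka%:C *: X^-1 - bt%:C *: X^-1 ^+ 2.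

Let Xu : X \is a GRing.unit. Proof. exact: unit_near_scalar norm_sub_mean. Qed.

Let mo0 : mo 0 = 1. Proof. by rewrite /mo expr0 poly_mean1. Qed.

Let moSS i : mo i.+2 =
  al * semicircle_mean a b 'X^(i.+1) + be * semicircle_mean a b 'X^i.
Proof. by rewrite /mo (poly_mean_moment a_gt0 muE). Qed.

Lemma dmonom_moments n : dmonom phi X n 1 1 = (\sum_(j < n) mo j * mo (n - j.+1)%N)%:C.
Proof.
rewrite rmorph_sum; apply: eq_bigr => j _.
by rewrite mul1r mulr1 !moment_poly_mean rmorphM.
Qed.

Lemma xi_moment n : phi (xi * X ^+ n.+2) = (al * mo n.+2 + ka * mo n.+1 - bt * mo n)%:C.
Proof.
have -> : xi * X ^+ n.+2 = al%:C *: X ^+ n.+2 + ka%:C *: X ^+ n.+1 - bt%:C *: X ^+ n.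
  rewrite /xi mulrBl mulrDl -!scalerAl mul1r; congr (_ + _ *: _ - _ *: _).
    by rewrite exprS mulrA mulVr// mul1r.
  by rewrite !exprS expr0 mulr1 -mulrA mulKr// mulKr.
rewrite linearB linearD /= !stateZ !moment_poly_mean.
by rewrite -!(rmorphM (real_complex R)) -(rmorphD (real_complex R)) -(rmorphB (real_complex R)).
Qed.

(** The equations in degree at least [4] come from the moments; lower degrees
    follow by dividing by [X]. *)
Lemma xi_conj n : monom_conj phi X xi n.
Proof.
apply: (monom_conj_all Hphi norm_sub_mean (n := 4)) => k k4.
rewrite -(subnKC k4) /monom_conj dmonom_moments xi_moment; congr (_%:C).
exact: (moment_rec (semicircle_mass ab) (semicircle_moments ab) mo0 moSS).
Qed.

(** The second Schwinger-Dyson equation is linear in the first moment, which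
    replaces the integral of [1 / t] against the semicircle. *)
Lemma first_moment : ka * mo 1 = m * be + al * v * (2 - al * m - be).
Proof.
have := xi_conj 2; rewrite /monom_conj xi_moment dmonom_moments => /complexI.
rewrite big_ord_recl big_ord1 /= moSS mo0.
have s0 := semicircle_mass ab; have := semicircle_moments ab 0.
rewrite big_ord0 s0 => /eqP; rewrite subr_eq0 => /eqP ->.
by rewrite /bt -/v -/m; move: (mo 1) => y; lra.
Qed.
End WeightedSemicircleElement.

(** * The theorem *)

(** The endpoint equations turn the unknown coefficients of the conjugate variable
    into [1 + la] and [beta]; they enter through [4 v = m^2 - a b]. *)
Lemma free_GIG_coefficients (R : realType) (la al beta a b mo1 : R) : 0 < la -> 0 < a -> a < b ->
  1 + la + al * Num.sqrt (a * b) - beta * ((a + b) / (2 * a * b)) = 0 ->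
  1 - la + beta / Num.sqrt (a * b) - al * ((a + b) / 2) = 0 ->
  let be := beta / Num.sqrt (a * b) in let m := (a + b) / 2 in
  let v := ((b - a) / 4) ^+ 2 in
  (be - m * al + 2) * mo1 = m * be + al * v * (2 - al * m - be) ->
  be - m * al + 2 = 1 + la /\ m * be + 2 * al * v - 2 * mo1 = beta.
Proof.
move=> la0 a0 ab e1 e2 be m v; have b0 : 0 < b by exact: lt_trans ab.
set q := Num.sqrt (a * b) in e1 e2 be *.
have q0 : q != 0 by rewrite gt_eqF// sqrtr_gt0 mulr_gt0.
have qq : q ^+ 2 = a * b by rewrite sqr_sqrtr// ltW// mulr_gt0.
have eka : be - m * al + 2 = 1 + la by move: e2; rewrite -/be -/m; lra.
have ebeta : beta = be * q by rewrite /be divfK.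
have ev : 4 * v = m ^+ 2 - q ^+ 2 by rewrite qq /v /m; field.
have ek : (1 + la) * q = be * m - al * q ^+ 2.
  have -> : be * m = q * (beta * ((a + b) / (2 * a * b))).
    have -> : 2 * a * b = 2 * q ^+ 2 by rewrite qq; ring.
    by rewrite /be /m; field.
  have -> : 1 + la = beta * ((a + b) / (2 * a * b)) - al * q by lra.
  by ring.
rewrite eka => h; split=> //; apply: (@mulfI _ (1 + la)); first by rewrite gt_eqF// addr_gt0.
have -> : (1 + la) * (m * be + 2 * al * v - 2 * mo1) =
  (1 + la) * (m * be + 2 * al * v) - 2 * ((1 + la) * mo1) by ring.
have -> : (1 + la) * beta = be * ((1 + la) * q) by rewrite ebeta; ring.
rewrite h ek -eka.
have -> : v = (m ^+ 2 - q ^+ 2) / 4 by rewrite -ev; field.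
by field.
Qed.

Theorem theorem3p3 (R : realType) (A : cstarAlgType R) (phi : {scalar A})
  (Hphi : cstar_probability_space phi)
  (alpha beta lambda : R)
  (alpha_gt0 : 0 < alpha) (beta_gt0 : 0 < beta) (lambda_gt1 : 1 < lambda)
  (mu nu : probability (measurableTypeR R) R)
  (Hmu : is_free_GIG (- lambda) alpha beta mu)
  (Hnu : is_free_Poisson lambda (1 / alpha) nu)
  (X Y : A)
  (HX : has_distribution phi X mu) (HY : has_distribution phi Y nu)
  (HXY : free_elements phi X Y) :
  [/\ X \is a GRing.unit, X + Y \is a GRing.unit
    & free_elements phi (X + Y)^-1 (X^-1 - (X + Y)^-1)].
Proof.
have la0 : 0 < lambda by exact: lt_trans lambda_gt1.
have [a [b [[a0 ab e1 e2] muE]]] := Hmu.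
rewrite opprK in e1; pose q := Num.sqrt (a * b); pose be := beta / q.
have q0 : 0 < q by rewrite sqrtr_gt0 mulr_gt0// (lt_trans a0).
have be0 : 0 <= be by rewrite divr_ge0// ltW.
have al0 := ltW alpha_gt0.
have {}muE E : measurable E -> mu E = (\int[@lebesgue_measure R]_(x in E `&`
      [set` Interval (BSide true a) (BSide false b)])
    ((alpha / x + be / x ^+ 2) * semicircle_density a b x)%:E)%E.
  move=> mE; rewrite muE//; apply: eq_integral => x _; congr (_%:E).
  rewrite /free_GIG_density /semicircle_density -/q [LHS]mulrC. congr ((_ + _) * _).
  by rewrite /be invfM mulrA.
have Xm := norm_sub_mean Hphi a0 ab al0 be0 muE HX.
have Xconj := xi_conj Hphi a0 ab al0 be0 muE HX.
have := first_moment Hphi a0 ab al0 be0 muE HX.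
move=> /(free_GIG_coefficients la0 a0 ab e1 e2)[eka ebt].
rewrite -/q -/be in eka ebt; rewrite eka ebt in Xconj.
(* The free Poisson law has [be = 0] and the endpoints [c < d]. *)
pose g : R := 1 / alpha; pose s := Num.sqrt lambda.
have g0 : 0 < g by rewrite divr_gt0.
have s1 : 1 < s by rewrite -sqrtr1 ltr_sqrt.
have ss : s ^+ 2 = lambda by rewrite sqr_sqrtr// ltW.
pose c := g * (1 - s) ^+ 2; pose d := g * (1 + s) ^+ 2.
have c0 : 0 < c by rewrite mulr_gt0// exprn_even_gt0//= subr_eq0 lt_eqF.
have cd : c < d by rewrite ltr_pM2l//; move: s1; clearbody s; nra.
have z0 : 0 <= 0 :> R by [].
have nuE E : measurable E -> nu E = (\int[@lebesgue_measure R]_(x in E `&`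
      [set` Interval (BSide false c) (BSide true d)])
    ((alpha / x + 0 / x ^+ 2) * semicircle_density c d x)%:E)%E.
  move=> mE; rewrite Hnu// max_l ?subr_le0 ?ltW// mul0e add0e.
  apply: eq_integral => x; rewrite inE => -[_] /=; rewrite in_itv /= => /andP[cx _].
  congr (_%:E); have x0 : x != 0 by rewrite gt_eqF// (lt_trans c0).
  rewrite /free_Poisson_density /semicircle_density mul0r addr0.
  have -> : 4 * lambda * (1 / alpha) ^+ 2 - (x - 1 / alpha * (1 + lambda)) ^+ 2 =
      (x - c) * (d - x).
    by rewrite -/g -ss /c /d; ring.
  move: (Num.sqrt _) (pi : R) (pi_gt0 R) => t p p0.
  by field; rewrite x0 !gt_eqF.
have Ym := norm_sub_mean Hphi c0 cd al0 z0 nuE HY.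
have Yconj := xi_conj Hphi c0 cd al0 z0 nuE HY.
have emo1 : poly_mean nu 'X^1 = alpha * ((d - c) / 4) ^+ 2.
  by rewrite (poly_mean_moment1 c0 nuE)// (semicircle_mass cd).
have ekaY : 0 - (c + d) / 2 * alpha + 2 = 1 - lambda.
  have -> : c + d = 2 * g * (1 + lambda) by rewrite -ss /c /d; ring.
  by rewrite /g; field; rewrite gt_eqF.
have ebtY : (c + d) / 2 * 0 + 2 * alpha * ((d - c) / 4) ^+ 2 - 2 * poly_mean nu 'X^1 = 0.
  by rewrite emo1; ring.
rewrite ekaY ebtY in Yconj.
have Xu := unit_near_scalar Xm; have Yu := unit_near_scalar Ym.
set m := (a + b) / 2 in Xm; set m' := (c + d) / 2 in Ym.
have Sm : nrm (X + Y - (m + m')%:C%:A) < m + m'.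
  rewrite rmorphD /= scalerDl opprD addrACA.
  by rewrite (le_lt_trans (ler_cstar_normD _ _))// ltrD.
have Su := unit_near_scalar Sm; split=> //.
pose l : R[i] := (lambda - 1)%:C.
pose x := pair_var X Y; pose xi := gig_poisson_conj X Y alpha%:C beta%:C l.
have xiX : xi true = alpha%:C *: 1 + (1 + lambda)%:C *: X^-1 - beta%:C *: X^-1 ^+ 2.
  rewrite /xi /gig_poisson_conj; congr (_ + _ *: _ - _).
  by rewrite /l -(rmorph_nat (real_complex R)) -rmorphD /=; congr (_%:C); ring.
have xiY : xi false = alpha%:C *: 1 + (1 - lambda)%:C *: Y^-1 - 0%:C *: Y^-1 ^+ 2.
  rewrite /xi /gig_poisson_conj scale0r subr0; congr (_ + _).
  by rewrite /l -scaleNr -rmorphN opprB.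
have fr : free_subalgebras phi (fun i => generated_algebra (x i)).
  by move: HXY; rewrite /free_elements; congr free_subalgebras; apply/funext => -[].
have xi_pow i n : phi (xi i * x i ^+ n) =
    \sum_(j < n) (phi (x i ^+ j) : R[i]) * phi (x i ^+ (n - j.+1)).
  have -> : \sum_(j < n) (phi (x i ^+ j) : R[i]) * phi (x i ^+ (n - j.+1)) =
      dmonom phi (x i) n 1 1.
    by apply: eq_bigr => j _; rewrite mul1r mulr1.
  by case: i; [rewrite xiX; exact: Xconj|rewrite xiY; exact: Yconj].
have xi_cl i (eps : R) : 0 < eps ->
    exists2 p, generated_algebra (x i) p & nrm (xi i - p) <= eps.
  case: i; [rewrite xiX; exact: (inv_in_closure Hphi _ _ _ Xm)|].
  rewrite xiY; exact: (inv_in_closure Hphi _ _ _ Ym).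
(* From polynomials to rational expressions by the graph closure. *)
apply: (@free_of_conj_rat _ _ _ Hphi X Y alpha%:C beta%:C l) => // p e rat_e.
have gr y f : family_gen phi x y f -> regular_form f.
  by move=> [i [_ ->]]; exact: dvar_regular.
have gX : dgraph (family_gen phi x) X (dvar phi true) by apply: dgraph_gen; exists true.
have gY : dgraph (family_gen phi x) Y (dvar phi false) by apply: dgraph_gen; exists false.
apply: (conj_eq_closure Hphi (G := dgraph (family_gen phi x))).
  by move=> y f; exact: free_conj.
apply: (gclosure_dgraph gr _ rat_e) => y f [[-> ->]|[-> ->]|[-> ->]|[-> ->]].
- by apply: gclosure_sub => //; exact: dvar_regular.
- by apply: gclosure_sub => //; exact: dvar_regular.
- exact: (gclosure_inv gr gX Xm).
- apply: (gclosure_inv gr _ Sm).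
  by rewrite -[X in X + _]scale1r; exact: dgraph_lin.
Qed.
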